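(* Let $\Lambda$ be an $\Omega_{\mathcal{G}}$-algebra and let $A$ be an indecomposable non-projective module in $\mathrm{Gprj}\text{-}\Lambda$. Consider the short exact sequences $$0\to\Omega^2_\Lambda(A)\xrightarrow{i_1}Q\xrightarrow{p_1}\Omega_\Lambda(A)\to0,\qquad 0\to\Omega_\Lambda(A)\xrightarrow{i_0}P\xrightarrow{p_0}A\to0$$ induced by the minimal projective resolution of $A$. Then the short exact sequence $$0\to\left(\begin{smallmatrix} Q \\ \Omega_\Lambda(A) \end{smallmatrix}\right)_{p_1}\xrightarrow{\left(\begin{smallmatrix} \phi_1 \\ \phi_2 \end{smallmatrix}\right)}\left(\begin{smallmatrix} Q \\ P \end{smallmatrix}\right)_{i_0p_1}\oplus\left(\begin{smallmatrix} \Omega_\Lambda(A) \\ \Omega_\Lambda(A) \end{smallmatrix}\right)_1\xrightarrow{(\psi_1\ \psi_2)}\left(\begin{smallmatrix} \Omega_\Lambda(A) \\ P \end{smallmatrix}\right)_{i_0}\to0$$ with $\phi_1=\left(\begin{smallmatrix} 1 \\ i_0 \end{smallmatrix}\right)$, $\phi_2=\left(\begin{smallmatrix} p_1 \\ 1 \end{smallmatrix}\right)$, $\psi_1=\left(\begin{smallmatrix} p_1 \\ 1 \end{smallmatrix}\right)$, $\psi_2=\left(\begin{smallmatrix} -1 \\ -i_0 \end{smallmatrix}\right)$ is an almost split sequence in $\mathrm{H}(\mathrm{Gprj}\text{-}\Lambda)$. Further, the object $\left(\begin{smallmatrix} Q \\ P \end{smallmatrix}\right)_{i_0p_1}$ is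 indecomposable.
   Context: Modules are finitely generated right modules. For an Artin algebra $\Lambda$, a module is Gorenstein projective if it is isomorphic to a syzygy of an acyclic complex $P^\bullet$ of finitely generated projectives such that $\mathrm{Hom}_\Lambda(P^\bullet,\Lambda)$ is also acyclic. $\mathrm{Gprj}\text{-}\Lambda$ is the full subcategory of these modules and $\underline{\mathrm{Gprj}}\text{-}\Lambda$ its stable category (morphisms modulo those factoring through projectives). $\mathrm{mod}\text{-}\mathcal{X}$ denotes finitely presented contravariant additive functors $\mathcal{X}\to\mathrm{Ab}$. An Artin algebra $\Lambda$, with $\mathrm{Gprj}\text{-}\Lambda$ contravariantly finite in $\mathrm{mod}\text{-}\Lambda$, is an $\Omega_{\mathcal{G}}$-algebra if $\mathrm{mod}\text{-}(\underline{\mathrm{Gprj}}\text{-}\Lambda)$ is a semisimple abelian category (all objects projective). $\mathrm{H}(\Lambda)$ is the morphism category of $\mathrm{mod}\text{-}\Lambda$: objects $\left(\begin{smallmatrix} A \\ B \end{smallmatrix}\right)_f$ are $\Lambda$-homomorphisms $f:A\to B$; a morphism $\left(\begin{smallmatrix} \alpha \\ \beta \end{smallmatrix}\right):\left(\begin{smallmatrix} A \\ B \end{smallmatrix}\right)_f\to\left(\begin{smallmatrix} C \\ D \end{smallmatrix}\right)_g$ is a pair $\alpha:A\to C$, $\beta:B\to D$ with $\beta f=g\alpha$. $\mathrm{H}(\mathrm{Gprj}\text{-}\Lambda)$ is the full subcategory of objects with $A,B\in\mathrm{Gprj}\text{-}\Lambda$. An almost split sequence in such a subcategory is a short exact sequence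 with terms in the subcategory whose left map is minimal left almost split and whose right map is minimal right almost split in the subcategory. *)

(* Defs.v *)
From HB Require Import structures.
From mathcomp Require Import all_boot all_algebra ring_quotient.
From mathcomp Require Import boolp.

Set Implicit Arguments.
Unset Strict Implicit.
Unset Printing Implicit Defensive.

Import GRing.Theory.
Local Open Scope ring_scope.

(* Two structures are used for size reasons.  Additive categories of modules  *)
(* have small homs (zmodType's), so that Hom(-, X) is a functor to zmodType,  *)
(* whereas categories of functors on them have homs in a larger universe.     *)
Record category := Category {
  obj :> Type;
  mor : obj -> obj -> Type;
  idm : forall X, mor X X;
  cmp : forall X Y Z, mor Y Z -> mor X Y -> mor X Z;
  cmpA : forall X Y Z T (h : mor Z T) (g : mor Y Z) (f : mor X Y),
    cmp h (cmp g f) = cmp (cmp h g) f;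
  cmp1f : forall X Y (f : mor X Y), cmp (idm Y) f = f;
  cmpf1 : forall X Y (f : mor X Y), cmp f (idm X) = f }.

Arguments idm {c} X.
Notation "g \oc f" := (cmp g f) (at level 40, left associativity).

Section CategoryTheory.
Variable C : category.
Implicit Types X Y Z : C.

Definition isomorphism X Y (f : mor X Y) : Prop :=
  exists g : mor Y X, g \oc f = idm X /\ f \oc g = idm Y.

Definition monomorphism X Y (f : mor X Y) : Prop :=
  forall T (g h : mor T X), f \oc g = f \oc h -> g = h.

Definition epimorphism X Y (f : mor X Y) : Prop :=
  forall T (g h : mor Y T), g \oc f = h \oc f -> g = h.

Definition split_mono X Y (f : mor X Y) : Prop :=
  exists g : mor Y X, g \oc f = idm X.

Definition split_epi X Y (f : mor X Y) : Prop :=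
  exists g : mor Y X, f \oc g = idm Y.

Definition zero_object Z : Prop :=
  forall X, (exists! f : mor X Z, True) /\ (exists! f : mor Z X, True).

Definition zero_morphism X Y (f : mor X Y) : Prop :=
  exists Z, zero_object Z /\ exists (a : mor X Z) (b : mor Z Y), f = b \oc a.

Definition is_kernel K X Y (i : mor K X) (f : mor X Y) : Prop :=
  zero_morphism (f \oc i) /\
  forall T (h : mor T X), zero_morphism (f \oc h) ->
    exists! u : mor T K, i \oc u = h.

Definition is_cokernel X Y Q (p : mor Y Q) (f : mor X Y) : Prop :=
  zero_morphism (p \oc f) /\
  forall T (h : mor Y T), zero_morphism (h \oc f) ->
    exists! u : mor Q T, u \oc p = h.

Definition is_product X1 X2 P (p1 : mor P X1) (p2 : mor P X2) : Prop :=
  forall T (f1 : mor T X1) (f2 : mor T X2),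
    exists! u : mor T P, p1 \oc u = f1 /\ p2 \oc u = f2.

Definition is_coproduct X1 X2 S (i1 : mor X1 S) (i2 : mor X2 S) : Prop :=
  forall T (f1 : mor X1 T) (f2 : mor X2 T),
    exists! u : mor S T, u \oc i1 = f1 /\ u \oc i2 = f2.

(* Freyd's axioms, which determine the additive structure on the homs. *)
Record abelian_category : Prop := AbelianCategory {
  has_zero : exists Z, zero_object Z;
  has_products : forall X1 X2, exists P (p1 : mor P X1) (p2 : mor P X2),
    is_product p1 p2;
  has_coproducts : forall X1 X2, exists S (i1 : mor X1 S) (i2 : mor X2 S),
    is_coproduct i1 i2;
  has_kernels : forall X Y (f : mor X Y), exists K (i : mor K X),
    is_kernel i f;
  has_cokernels : forall X Y (f : mor X Y), exists Q (p : mor Y Q),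
    is_cokernel p f;
  mono_normal : forall X Y (f : mor X Y), monomorphism f ->
    exists Z (g : mor Y Z), is_kernel f g;
  epi_normal : forall X Y (f : mor X Y), epimorphism f ->
    exists Z (g : mor Z X), is_cokernel f g }.

Definition projective_object P : Prop :=
  forall X Y (e : mor X Y) (f : mor P Y), epimorphism e ->
    exists h : mor P X, e \oc h = f.

Definition semisimple_abelian : Prop :=
  abelian_category /\ forall X, projective_object X.

Definition short_exact X Y Z (f : mor X Y) (g : mor Y Z) : Prop :=
  is_kernel f g /\ is_cokernel g f.

Definition left_minimal X Y (f : mor X Y) : Prop :=
  forall h : mor Y Y, h \oc f = f -> isomorphism h.

Definition right_minimal X Y (g : mor X Y) : Prop :=
  forall h : mor X X, g \oc h = g -> isomorphism h.

(* S is the predicate on objects defining a full subcategory of C. *)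
Variable S : C -> Prop.

Definition left_almost_split X Y (f : mor X Y) : Prop :=
  ~ split_mono f /\
  forall T (h : mor X T), S T -> ~ split_mono h ->
    exists u : mor Y T, u \oc f = h.

Definition right_almost_split X Y (g : mor X Y) : Prop :=
  ~ split_epi g /\
  forall T (h : mor T Y), S T -> ~ split_epi h ->
    exists u : mor T X, g \oc u = h.

Record almost_split_sequence X Y Z (f : mor X Y) (g : mor Y Z) : Prop :=
  AlmostSplitSequence {
    ass_left_term : S X;
    ass_middle_term : S Y;
    ass_right_term : S Z;
    ass_exact : short_exact f g;
    ass_left_almost_split : left_almost_split f;
    ass_left_minimal : left_minimal f;
    ass_right_almost_split : right_almost_split g;
    ass_right_minimal : right_minimal g }.

Definition full_sub : category :=
  let O := {X : C | S X} in
  @Category O (fun X Y : O => mor (sval X) (sval Y))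
    (fun X : O => idm (sval X)) (fun (X Y Z : O) g f => g \oc f)
    (fun (X Y Z T : O) h g f => cmpA h g f)
    (fun (X Y : O) f => cmp1f f) (fun (X Y : O) f => cmpf1 f).

End CategoryTheory.

Record preadditive := Preadditive {
  pobj :> Type;
  phom : pobj -> pobj -> zmodType;
  hid : forall X, phom X X;
  hcomp : forall X Y Z, phom Y Z -> phom X Y -> phom X Z;
  hcompA : forall X Y Z T (h : phom Z T) (g : phom Y Z) (f : phom X Y),
    hcomp h (hcomp g f) = hcomp (hcomp h g) f;
  hcomp1f : forall X Y (f : phom X Y), hcomp (hid Y) f = f;
  hcompf1 : forall X Y (f : phom X Y), hcomp f (hid X) = f;
  hcompDl : forall X Y Z (g g' : phom Y Z) (f : phom X Y),
    hcomp (g + g') f = hcomp g f + hcomp g' f;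
  hcompDr : forall X Y Z (g : phom Y Z) (f f' : phom X Y),
    hcomp g (f + f') = hcomp g f + hcomp g f' }.

Arguments hid {p} X.
Notation "g \oh f" := (hcomp g f) (at level 40, left associativity).

Definition cat_of (C : preadditive) : category :=
  @Category C (fun X Y => phom X Y) (@hid C) (@hcomp C)
    (@hcompA C) (@hcomp1f C) (@hcompf1 C).
Coercion cat_of : preadditive >-> category.
Canonical cat_of.

Section PreadditiveTheory.
Variable C : preadditive.
Implicit Types X Y Z : C.

Lemma hcomp0l X Y Z (f : phom X Y) : (0 : phom Y Z) \oh f = 0.
Proof. by apply: (addIr (0 \oh f)); rewrite -hcompDl !add0r. Qed.

Lemma hcomp0r X Y Z (g : phom Y Z) : g \oh (0 : phom X Y) = 0.
Proof. by apply: (addIr (g \oh 0)); rewrite -hcompDr !add0r. Qed.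

Lemma hcompNl X Y Z (g : phom Y Z) (f : phom X Y) : (- g) \oh f = - (g \oh f).
Proof. by apply/eqP; rewrite -addr_eq0 -hcompDl addNr hcomp0l. Qed.

Lemma hcompNr X Y Z (g : phom Y Z) (f : phom X Y) : g \oh (- f) = - (g \oh f).
Proof. by apply/eqP; rewrite -addr_eq0 -hcompDr addNr hcomp0r. Qed.

Lemma hcompBl X Y Z (g g' : phom Y Z) (f : phom X Y) :
  (g - g') \oh f = g \oh f - g' \oh f.
Proof. by rewrite hcompDl hcompNl. Qed.

Lemma hcompBr X Y Z (g : phom Y Z) (f f' : phom X Y) :
  g \oh (f - f') = g \oh f - g \oh f'.
Proof. by rewrite hcompDr hcompNr. Qed.

Definition is_biproduct X1 X2 X (i1 : phom X1 X) (i2 : phom X2 X)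
    (p1 : phom X X1) (p2 : phom X X2) : Prop :=
  [/\ p1 \oh i1 = hid X1, p2 \oh i2 = hid X2, p1 \oh i2 = 0, p2 \oh i1 = 0
    & i1 \oh p1 + i2 \oh p2 = hid X].

Definition indecomposable X : Prop :=
  ~ zero_object X /\
  forall X1 X2 (i1 : phom X1 X) (i2 : phom X2 X) (p1 : phom X X1) (p2 : phom X X2),
    is_biproduct i1 i2 p1 p2 -> zero_object X1 \/ zero_object X2.

Section DiagonalMap.
Variables (X1 X2 X Y1 Y2 Y : C).
Variables (i1 : phom X1 X) (i2 : phom X2 X) (p1 : phom X X1) (p2 : phom X X2).
Variables (j1 : phom Y1 Y) (j2 : phom Y2 Y) (q1 : phom Y Y1) (q2 : phom Y Y2).
Variables (f : phom X1 Y1) (g : phom X2 Y2).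
Hypotheses (hX : is_biproduct i1 i2 p1 p2) (hY : is_biproduct j1 j2 q1 q2).

Definition diag_map : phom X Y := j1 \oh f \oh p1 + j2 \oh g \oh p2.

Lemma diag_map_in1 : j1 \oh f = diag_map \oh i1.
Proof.
case: hX => e1 e2 e3 e4 _.
by rewrite hcompDl -!hcompA e1 e4 !hcomp0r addr0 hcompf1.
Qed.

Lemma diag_map_in2 : j2 \oh g = diag_map \oh i2.
Proof.
case: hX => e1 e2 e3 e4 _.
by rewrite hcompDl -!hcompA e2 e3 !hcomp0r add0r hcompf1.
Qed.

Lemma diag_map_pr1 : q1 \oh diag_map = f \oh p1.
Proof.
case: hY => e1 e2 e3 e4 _.
by rewrite hcompDr !hcompA e1 e3 !hcomp0l addr0 hcomp1f.
Qed.

Lemma diag_map_pr2 : q2 \oh diag_map = g \oh p2.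
Proof.
case: hY => e1 e2 e3 e4 _.
by rewrite hcompDr !hcompA e2 e4 !hcomp0l add0r hcomp1f.
Qed.

End DiagonalMap.

Definition pfull_sub (S : C -> Prop) : preadditive :=
  let O := {X : C | S X} in
  @Preadditive O (fun X Y : O => phom (sval X) (sval Y))
    (fun X : O => hid (sval X)) (fun (X Y Z : O) g f => g \oh f)
    (fun (X Y Z T : O) h g f => hcompA h g f)
    (fun (X Y : O) f => hcomp1f f) (fun (X Y : O) f => hcompf1 f)
    (fun (X Y Z : O) g g' f => hcompDl g g' f)
    (fun (X Y Z : O) g f f' => hcompDr g f f').

End PreadditiveTheory.

Record cat_ideal (C : preadditive) := CatIdeal {
  ideal_mem : forall X Y : C, phom X Y -> Prop;
  ideal0 : forall X Y : C, ideal_mem (0 : phom X Y);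
  idealB : forall (X Y : C) (f g : phom X Y),
    ideal_mem f -> ideal_mem g -> ideal_mem (f - g);
  idealMl : forall (X Y Z : C) (g : phom Y Z) (f : phom X Y),
    ideal_mem f -> ideal_mem (g \oh f);
  idealMr : forall (X Y Z : C) (g : phom Y Z) (f : phom X Y),
    ideal_mem g -> ideal_mem (g \oh f) }.

Section QuotientCategory.
Variables (C : preadditive) (I : cat_ideal C).

Definition ideal_pred (X Y : C) : phom X Y -> bool := fun f => `[< ideal_mem I f >].

Fact ideal_pred_closed (X Y : C) : zmod_closed (@ideal_pred X Y).
Proof.
split; first exact/asboolP/ideal0.
by move=> f g /asboolP If /asboolP Ig; apply/asboolP/idealB.
Qed.

Definition ideal_closed (X Y : C) : zmodClosed (phom X Y) :=
  HB.pack (@ideal_pred X Y) (GRing.isZmodClosed.Build (phom X Y)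
    (@ideal_pred X Y) (@ideal_pred_closed X Y)).

Definition qhom (X Y : C) : zmodType := Quotient.quot (ideal_closed X Y).

Definition qpi (X Y : C) (f : phom X Y) : qhom X Y :=
  \pi_(Quotient.quot (ideal_closed X Y))%qT f.

Definition qrep (X Y : C) (f : qhom X Y) : phom X Y :=
  @repr _ (Quotient.quot (ideal_closed X Y)) f.

Lemma qrepK (X Y : C) (f : qhom X Y) : qpi (qrep f) = f.
Proof. exact: reprK. Qed.

Lemma qpi_eq (X Y : C) (f g : phom X Y) : qpi f = qpi g <-> ideal_mem I (f - g).
Proof.
have e := Quotient.idealrBE (ideal_closed X Y) f g.
split=> [/eqP fg | Ifg]; first by apply/asboolP; move: e; rewrite unfold_in => ->.
by apply/eqP; rewrite /qpi -e unfold_in; apply/asboolP.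
Qed.

Lemma qpiD (X Y : C) (f g : phom X Y) : qpi (f + g) = qpi f + qpi g.
Proof. by rewrite /qpi raddfD. Qed.

Definition qcomp (X Y Z : C) (g : qhom Y Z) (f : qhom X Y) : qhom X Z :=
  qpi (qrep g \oh qrep f).

Lemma qcompE (X Y Z : C) (g : phom Y Z) (f : phom X Y) :
  qcomp (qpi g) (qpi f) = qpi (g \oh f).
Proof.
set g' := qrep (qpi g); set f' := qrep (qpi f).
have Ig : ideal_mem I (g' - g) by apply/qpi_eq; rewrite qrepK.
have If : ideal_mem I (f' - f) by apply/qpi_eq; rewrite qrepK.
apply/qpi_eq; rewrite -/g' -/f'.
have -> : g' \oh f' - g \oh f = g' \oh (f' - f) - (g - g') \oh f.
  by rewrite hcompBr hcompBl opprB addrA subrK.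
apply: idealB; first exact: idealMl.
by apply: idealMr; rewrite -opprB -sub0r; apply: idealB => //; apply: ideal0.
Qed.

Definition quot_cat : preadditive.
Proof.
refine (@Preadditive C qhom (fun X => qpi (hid X)) qcomp _ _ _ _ _).
- move=> X Y Z T h g f; rewrite -(qrepK h) -(qrepK g) -(qrepK f).
  by rewrite !qcompE hcompA.
- by move=> X Y f; rewrite -(qrepK f) qcompE hcomp1f.
- by move=> X Y f; rewrite -(qrepK f) qcompE hcompf1.
- move=> X Y Z g g' f; rewrite -(qrepK g) -(qrepK g') -(qrepK f).
  by rewrite -qpiD !qcompE -qpiD hcompDl.
- move=> X Y Z g f f'; rewrite -(qrepK g) -(qrepK f) -(qrepK f').
  by rewrite -qpiD !qcompE -qpiD hcompDr.
Defined.

End QuotientCategory.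

Record mor_obj (C : preadditive) := MorObj {
  mdom : C;
  mcod : C;
  marr :> phom mdom mcod }.

Section MorphismCategory.
Variable C : preadditive.
Implicit Types X Y Z : mor_obj C.

Definition comm_square X Y :
    (phom (mdom X) (mdom Y) * phom (mcod X) (mcod Y))%type -> bool :=
  fun ab => ab.2 \oh marr X == marr Y \oh ab.1.

Fact comm_square_closed X Y : zmod_closed (@comm_square X Y).
Proof.
split; first by rewrite unfold_in /comm_square /= hcomp0l hcomp0r.
move=> u v; rewrite !unfold_in /comm_square /= => /eqP hu /eqP hv.
by rewrite hcompBl hcompBr hu hv.
Qed.

HB.instance Definition _ X Y := GRing.isZmodClosed.Build
  (phom (mdom X) (mdom Y) * phom (mcod X) (mcod Y))%type
  (@comm_square X Y) (@comm_square_closed X Y).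

Record mor_hom X Y := MorHom {
  mor_pair :> phom (mdom X) (mdom Y) * phom (mcod X) (mcod Y);
  _ : comm_square mor_pair }.

HB.instance Definition _ X Y := [isSub for @mor_pair X Y].
HB.instance Definition _ X Y := [Choice of mor_hom X Y by <:].
HB.instance Definition _ X Y := [SubChoice_isSubZmodule of mor_hom X Y by <:].

Lemma mor_homP X Y (f : mor_hom X Y) :
  f.2 \oh marr X = marr Y \oh f.1.
Proof. by case: f => ab /= /eqP. Qed.

Definition mkmor X Y (a : phom (mdom X) (mdom Y)) (b : phom (mcod X) (mcod Y))
    (h : b \oh marr X = marr Y \oh a) : mor_hom X Y :=
  @MorHom X Y (a, b) (introT eqP h).

Lemma mor_hom_eq X Y (f g : mor_hom X Y) : f.1 = g.1 -> f.2 = g.2 -> f = g.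
Proof.
move=> e1 e2; apply: val_inj => /=.
by move: (mor_pair f) (mor_pair g) e1 e2 => [? ?] [? ?] /= -> ->.
Qed.

Fact mor_id_comm X : hid (mcod X) \oh marr X = marr X \oh hid (mdom X).
Proof. by rewrite hcomp1f hcompf1. Qed.

Fact mor_comp_comm X Y Z (g : mor_hom Y Z) (f : mor_hom X Y) :
  (g.2 \oh f.2) \oh marr X = marr Z \oh (g.1 \oh f.1).
Proof. by rewrite -hcompA mor_homP hcompA mor_homP hcompA. Qed.

Definition mor_cat : preadditive.
Proof.
refine (@Preadditive (mor_obj C) (fun X Y => mor_hom X Y : zmodType)
  (fun X => mkmor (mor_id_comm X)) (fun X Y Z g f => mkmor (mor_comp_comm g f))
  _ _ _ _ _).
- by move=> X Y Z T h g f; apply: mor_hom_eq; rewrite /= hcompA.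
- by move=> X Y f; apply: mor_hom_eq; rewrite /= hcomp1f.
- by move=> X Y f; apply: mor_hom_eq; rewrite /= hcompf1.
- by move=> X Y Z g g' f; apply: mor_hom_eq; rewrite /= hcompDl.
- by move=> X Y Z g f f'; apply: mor_hom_eq; rewrite /= hcompDr.
Defined.

(* The objects of H(C) both of whose ends lie in a full subcategory of C. *)
Definition mor_in (S : C -> Prop) (X : mor_cat) : Prop :=
  S (mdom X) /\ S (mcod X).

End MorphismCategory.

Record presheaf (C : preadditive) := Presheaf {
  fobj :> C -> zmodType;
  fmap : forall X Y : C, phom X Y -> fobj Y -> fobj X;
  fmapB : forall (X Y : C) (f : phom X Y) (x y : fobj Y),
    fmap f (x - y) = fmap f x - fmap f y;
  fmap1 : forall (X : C) (x : fobj X), fmap (hid X) x = x;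
  fmapM : forall (X Y Z : C) (g : phom Y Z) (f : phom X Y) (x : fobj Z),
    fmap (g \oh f) x = fmap f (fmap g x);
  fmapD : forall (X Y : C) (f g : phom X Y) (x : fobj Y),
    fmap (f + g) x = fmap f x + fmap g x }.

Record nat_trans (C : preadditive) (F G : presheaf C) := NatTrans {
  nt :> forall X : C, F X -> G X;
  ntB : forall (X : C) (x y : F X), nt (x - y) = nt x - nt y;
  nt_nat : forall (X Y : C) (f : phom X Y) (x : F Y),
    nt (fmap f x) = fmap f (nt x) }.

Section FunctorCategory.
Variable C : preadditive.
Implicit Types F G H : presheaf C.

Lemma nat_trans_eq F G (u v : nat_trans F G) :
  (forall X (x : F X), u X x = v X x) -> u = v.
Proof.
case: u v => [u uB un] [v vB vn] /= e.
have {}e : u = v by apply: functional_extensionality_dep => X; apply/funext/e.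
by move: vB vn; rewrite -e => vB vn; congr NatTrans; apply: Prop_irrelevance.
Qed.

Definition nt_id F : nat_trans F F.
Proof. by exists (fun X x => x). Defined.

Definition nt_comp F G H (v : nat_trans G H) (u : nat_trans F G) :
  nat_trans F H.
Proof.
exists (fun X x => v X (u X x)) => [X x y | X Y f x]; first by rewrite !ntB.
by rewrite !nt_nat.
Defined.

Definition fun_cat : category.
Proof.
by refine (@Category (presheaf C) (@nat_trans C) nt_id nt_comp _ _ _);
  move=> *; apply: nat_trans_eq.
Defined.

Definition yoneda (X : C) : presheaf C.
Proof.
refine (@Presheaf C (fun Y => phom Y X) (fun Y Z f g => g \oh f) _ _ _ _).
- by move=> Y Z f g g'; rewrite hcompBl.
- by move=> Y f; rewrite hcompf1.
- by move=> Y Z T g f h; rewrite hcompA.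
- by move=> Y Z f f' g; rewrite hcompDr.
Defined.

(* Hom(-, X1) -> Hom(-, X0) -> F -> 0 is exact. *)
Definition finitely_presented F : Prop :=
  exists (X1 X0 : C) (u : nat_trans (yoneda X1) (yoneda X0))
         (p : nat_trans (yoneda X0) F),
    (forall (Y : C) (y : F Y), exists x, p Y x = y) /\
    (forall (Y : C) (x : yoneda X0 Y), p Y x = 0 <-> exists z, u Y z = x).

Definition fp_functors : category := full_sub (C := fun_cat) finitely_presented.

End FunctorCategory.

Definition finitely_generated (R : pzRingType) (M : lmodType R) : Prop :=
  exists (n : nat) (e : 'I_n -> M), forall x : M,
    exists c : 'I_n -> R, x = \sum_(i < n) c i *: e i.

Definition is_submodule (R : pzRingType) (M : lmodType R) (N : M -> Prop) :
    Prop :=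
  [/\ N 0, forall x y, N x -> N y -> N (x + y)
    & forall (a : R) x, N x -> N (a *: x)].

Definition artinian_module (R : pzRingType) (M : lmodType R) : Prop :=
  forall N : nat -> M -> Prop,
    (forall n, is_submodule (N n)) ->
    (forall n x, N n.+1 x -> N n x) ->
    exists n0, forall n, (n0 <= n)%N -> forall x, N n0 x -> N n x.

Definition artin_algebra (k : comNzRingType) (L : algType k) : Prop :=
  artinian_module (k^o : lmodType k) /\
  finitely_generated (L : lmodType k).

Section LinearZmodule.
Variables (R : pzRingType) (U V : lmodType R).

Lemma linear_ext (f g : {linear U -> V}) : f =1 g -> f = g.
Proof.
case: f g => [f [[f1] [f2]]] [g [[g1] [g2]]] /= /funext e.
by move: g1 g2; rewrite -e => g1 g2;
  congr (GRing.Linear.Pack (GRing.Linear.Class _ _));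
  [congr GRing.isNmodMorphism.Axioms_ | congr GRing.isScalable.Axioms_];
  apply: Prop_irrelevance.
Qed.

HB.instance Definition _ := gen_eqMixin {linear U -> V}.
HB.instance Definition _ := gen_choiceMixin {linear U -> V}.

Definition lin0 : {linear U -> V} := \0.
Definition linD (f g : {linear U -> V}) : {linear U -> V} := f \+ g.
Definition linN (f : {linear U -> V}) : {linear U -> V} := \- f.

Fact linDA : associative linD.
Proof. by move=> f g h; apply: linear_ext => x /=; rewrite addrA. Qed.
Fact linDC : commutative linD.
Proof. by move=> f g; apply: linear_ext => x /=; rewrite addrC. Qed.
Fact lin0D : left_id lin0 linD.
Proof. by move=> f; apply: linear_ext => x /=; rewrite add0r. Qed.
Fact linND : left_inverse lin0 linN linD.
Proof. by move=> f; apply: linear_ext => x /=; rewrite addNr. Qed.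

HB.instance Definition _ :=
  GRing.isZmodule.Build {linear U -> V} linDA linDC lin0D linND.

End LinearZmodule.

(* A right L-module is an lmodType over the converse ring L^c, with x . a     *)
(* written a *: x.                                                            *)
Record modr (L : nzRingType) := Modr {
  modr_sort :> lmodType L^c;
  modr_fg : finitely_generated modr_sort }.

Definition mod_cat (L : nzRingType) : preadditive.
Proof.
refine (@Preadditive (modr L) (fun X Y => {linear X -> Y} : zmodType)
  (fun X => idfun : {linear X -> X})
  (fun X Y Z (g : {linear Y -> Z}) (f : {linear X -> Y}) =>
     (g \o f)%FUN : {linear X -> Z}) _ _ _ _ _).
- by move=> *; apply: linear_ext.
- by move=> *; apply: linear_ext.
- by move=> *; apply: linear_ext.
- by move=> *; apply: linear_ext.
- by move=> X Y Z g f f'; apply: linear_ext => x /=; rewrite raddfD.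
Defined.

Definition H_cat (L : nzRingType) : preadditive := mor_cat (mod_cat L).

Section DirectSum.
Variable L : nzRingType.
Implicit Types X Y : modr L.

Fact dsum_fg X Y : finitely_generated (X * Y)%type.
Proof.
case: (modr_fg X) => m [e He]; case: (modr_fg Y) => n [f Hf].
exists (m + n)%N, (fun i => match split i with
  | inl j => (e j, 0) | inr j => (0, f j) end) => -[x y].
case: (He x) => c ->; case: (Hf y) => d ->.
exists (fun i => match split i with inl j => c j | inr j => d j end).
have sl (i : 'I_m) : split (lshift n i) = inl i by exact: (unsplitK (inl i)).
have sr (i : 'I_n) : split (rshift m i) = inr i by exact: (unsplitK (inr i)).
rewrite big_split_ord [LHS]surjective_pairing [RHS]surjective_pairing.
congr pair.
  rewrite [RHS]raddfD !raddf_sum /= [X in _ + X]big1 => [|i _].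
    by rewrite addr0; apply: eq_bigr => i _; rewrite sl.
  by rewrite sr /= scaler0.
rewrite [RHS]raddfD !raddf_sum /= [X in X + _]big1 => [|i _].
  by rewrite add0r; apply: eq_bigr => i _; rewrite sr.
by rewrite sl /= scaler0.
Qed.

Definition dsum X Y : mod_cat L := Modr (@dsum_fg X Y).

Section Maps.
Variables X Y : modr L.

Definition inl_fun (x : X) : (X * Y)%type := (x, 0).
Definition inr_fun (y : Y) : (X * Y)%type := (0, y).

Fact inl_linear : linear inl_fun.
Proof. by move=> a x y; rewrite /inl_fun; congr pair; rewrite /= scaler0 addr0. Qed.
Fact inr_linear : linear inr_fun.
Proof. by move=> a x y; rewrite /inr_fun; congr pair; rewrite /= scaler0 addr0. Qed.

HB.instance Definition _ :=
  GRing.isLinear.Build L^c X (X * Y)%type *:%R inl_fun inl_linear.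
HB.instance Definition _ :=
  GRing.isLinear.Build L^c Y (X * Y)%type *:%R inr_fun inr_linear.

Definition din1 : @phom (mod_cat L) X (dsum X Y) := inl_fun : {linear _ -> _}.
Definition din2 : @phom (mod_cat L) Y (dsum X Y) := inr_fun : {linear _ -> _}.
Definition dpr1 : @phom (mod_cat L) (dsum X Y) X :=
  fst : {linear (X * Y)%type -> X}.
Definition dpr2 : @phom (mod_cat L) (dsum X Y) Y :=
  snd : {linear (X * Y)%type -> Y}.

Lemma dsum_biproduct : is_biproduct din1 din2 dpr1 dpr2.
Proof.
split; apply: linear_ext => //.
by case=> x y; congr pair; rewrite /= ?addr0 ?add0r.
Qed.

End Maps.
End DirectSum.

Section HDirectSum.
Variable L : nzRingType.
Implicit Types X Y : H_cat L.

Definition hsum X Y : H_cat L :=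
  @MorObj (mod_cat L) (dsum (mdom X) (mdom Y)) (dsum (mcod X) (mcod Y))
    (diag_map (dpr1 _ _) (dpr2 _ _) (din1 _ _) (din2 _ _) (marr X) (marr Y)).

Section Maps.
Variables X Y : H_cat L.

Fact hin1_comm :
  din1 (mcod X) (mcod Y) \oh marr X = marr (hsum X Y) \oh din1 (mdom X) (mdom Y).
Proof. exact: diag_map_in1 (dsum_biproduct _ _). Qed.

Fact hin2_comm :
  din2 (mcod X) (mcod Y) \oh marr Y = marr (hsum X Y) \oh din2 (mdom X) (mdom Y).
Proof. exact: diag_map_in2 (dsum_biproduct _ _). Qed.

Fact hpr1_comm :
  dpr1 (mcod X) (mcod Y) \oh marr (hsum X Y) = marr X \oh dpr1 (mdom X) (mdom Y).
Proof. exact: diag_map_pr1 (dsum_biproduct _ _). Qed.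

Fact hpr2_comm :
  dpr2 (mcod X) (mcod Y) \oh marr (hsum X Y) = marr Y \oh dpr2 (mdom X) (mdom Y).
Proof. exact: diag_map_pr2 (dsum_biproduct _ _). Qed.

Definition hin1 : phom X (hsum X Y) :=
  @mkmor (mod_cat L) X (hsum X Y) (din1 _ _) (din1 _ _) hin1_comm.
Definition hin2 : phom Y (hsum X Y) :=
  @mkmor (mod_cat L) Y (hsum X Y) (din2 _ _) (din2 _ _) hin2_comm.
Definition hpr1 : phom (hsum X Y) X :=
  @mkmor (mod_cat L) (hsum X Y) X (dpr1 _ _) (dpr1 _ _) hpr1_comm.
Definition hpr2 : phom (hsum X Y) Y :=
  @mkmor (mod_cat L) (hsum X Y) Y (dpr2 _ _) (dpr2 _ _) hpr2_comm.

Lemma hsum_biproduct : is_biproduct hin1 hin2 hpr1 hpr2.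
Proof.
have [a1 a2 a3 a4 a5] := dsum_biproduct (mdom X) (mdom Y).
have [b1 b2 b3 b4 b5] := dsum_biproduct (mcod X) (mcod Y).
by split; apply: mor_hom_eq.
Qed.

End Maps.

(* The column (phi1 phi2)^T and the row (psi1 psi2) of morphisms in H. *)
Definition hcol W X Y (phi1 : phom W X) (phi2 : phom W Y) : phom W (hsum X Y) :=
  hin1 X Y \oh phi1 + hin2 X Y \oh phi2.

Definition hrow X Y Z (psi1 : phom X Z) (psi2 : phom Y Z) : phom (hsum X Y) Z :=
  psi1 \oh hpr1 X Y + psi2 \oh hpr2 X Y.

End HDirectSum.

Section GorensteinProjective.
Variable L : nzRingType.
Local Notation mod_L := (mod_cat L).
Implicit Types M N P : mod_L.

Definition surj M N (f : phom M N) : Prop := forall y : N, exists x : M, f x = y.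

Definition projective_module P : Prop :=
  forall M N (e : phom M N) (f : phom P N), surj e ->
    exists h : phom P M, e \oh h = f.

Definition exact_sequence K M N (i : phom K M) (p : phom M N) : Prop :=
  [/\ injective i, surj p & forall x : M, p x = 0 <-> exists y : K, i y = x].

(* The third condition says that p is an essential epimorphism. *)
Definition projective_cover P M (p : phom P M) : Prop :=
  [/\ projective_module P, surj p
    & forall N (g : phom N P), surj (p \oh g) -> surj g].

Fact regular_fg : finitely_generated ((L^c)^o : lmodType L^c).
Proof.
exists 1%N, (fun=> 1) => x; exists (fun=> x).
by rewrite big_ord1 [RHS]mulr1.
Qed.

Definition regular_module : mod_L := Modr regular_fg.

Definition complex_acyclic (P : int -> mod_L)
    (d : forall n : int, phom (P n) (P (n + 1))) : Prop :=
  forall (n : int) (x : P (n + 1)), d (n + 1) x = 0 <-> exists y, d n y = x.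

Definition dual_acyclic (P : int -> mod_L)
    (d : forall n : int, phom (P n) (P (n + 1))) : Prop :=
  forall (n : int) (u : phom (P (n + 1)) regular_module),
    u \oh d n = 0 <->
    exists v : phom (P (n + 1 + 1)) regular_module, v \oh d (n + 1) = u.

(* The map i identifies M with the syzygy Ker (d n). *)
Definition Gprj M : Prop :=
  exists (P : int -> mod_L) (d : forall n : int, phom (P n) (P (n + 1))),
    [/\ forall n, projective_module (P n), complex_acyclic d, dual_acyclic d
      & exists (n : int) (i : phom M (P n)),
          injective i /\ forall x : P n, d n x = 0 <-> exists y, i y = x].

Definition Gprj_contravariantly_finite : Prop :=
  forall M, exists (G : mod_L) (g : phom G M), Gprj G /\
    forall (G' : mod_L) (f : phom G' M), Gprj G' ->
      exists h : phom G' G, g \oh h = f.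

Definition Gprj_cat : preadditive := pfull_sub Gprj.

Definition factors_projective M N (f : phom M N) : Prop :=
  exists P, projective_module P /\
    exists (a : phom M P) (b : phom P N), f = b \oh a.

Lemma dsum_projective P P' :
  projective_module P -> projective_module P' -> projective_module (dsum P P').
Proof.
move=> hP hP' M N e f es.
have [h eh] := hP M N e (f \oh din1 _ _) es.
have [h' eh'] := hP' M N e (f \oh din2 _ _) es.
exists (h \oh dpr1 _ _ + h' \oh dpr2 _ _).
have [_ _ _ _ b] := dsum_biproduct P P'.
by rewrite hcompDr !hcompA eh eh' -!hcompA -hcompDr b hcompf1.
Qed.

Lemma factors_projectiveB M N (f g : phom M N) :
  factors_projective f -> factors_projective g -> factors_projective (f - g).
Proof.
move=> [P [hP [a [b ->]]]] [P' [hP' [a' [b' ->]]]].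
exists (dsum P P'); split; first exact: dsum_projective.
exists (din1 _ _ \oh a + din2 _ _ \oh a'), (b \oh dpr1 _ _ - b' \oh dpr2 _ _).
have [e1 e2 e3 e4 _] := dsum_biproduct P P'.
set t := b \oh dpr1 P P' - _.
have t1 : t \oh din1 _ _ = b.
  by rewrite hcompBl -!hcompA e1 e4 hcomp0r subr0 hcompf1.
have t2 : t \oh din2 _ _ = - b'.
  by rewrite hcompBl -!hcompA e2 e3 hcomp0r sub0r hcompf1.
by rewrite hcompDr !hcompA t1 t2 hcompNl.
Qed.

Lemma projective0 : exists P, projective_module P.
Proof.
exists regular_module => M N e f es.
have [m em] := es (f 1).
have lin : linear (fun a : (L^c)^o => (a : L^c) *: m).
  by move=> a x y; rewrite scalerDl scalerA.
pose h : {linear (L^c)^o -> M} := HB.pack (fun a : (L^c)^o => (a : L^c) *: m)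
  (GRing.isLinear.Build _ _ _ _ _ lin).
exists h; apply: linear_ext => a /=.
by rewrite linearZ em -linearZ [_ *: _]mulr1.
Qed.

Lemma factors_projective0 M N : factors_projective (0 : phom M N).
Proof.
have [P hP] := projective0; exists P; split=> //.
by exists 0, 0; rewrite hcomp0l.
Qed.

Lemma factors_projectiveMl M N K (g : phom N K) (f : phom M N) :
  factors_projective f -> factors_projective (g \oh f).
Proof.
move=> [P [hP [a [b ->]]]]; exists P; split=> //.
by exists a, (g \oh b); rewrite hcompA.
Qed.

Lemma factors_projectiveMr M N K (g : phom N K) (f : phom M N) :
  factors_projective g -> factors_projective (g \oh f).
Proof.
move=> [P [hP [a [b ->]]]]; exists P; split=> //.
by exists (a \oh f), b; rewrite hcompA.
Qed.

Definition projective_ideal : cat_ideal Gprj_cat.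
Proof.
refine (@CatIdeal Gprj_cat
  (fun X Y (f : phom (sval X) (sval Y)) => factors_projective f) _ _ _ _).
- by move=> X Y; apply: factors_projective0.
- by move=> X Y f g; apply: factors_projectiveB.
- by move=> X Y Z g f; apply: factors_projectiveMl.
- by move=> X Y Z g f; apply: factors_projectiveMr.
Defined.

Definition stable_Gprj_cat : preadditive := quot_cat projective_ideal.

End GorensteinProjective.

Definition OmegaG_algebra (k : comNzRingType) (L : algType k) : Prop :=
  [/\ artin_algebra L, Gprj_contravariantly_finite L
    & semisimple_abelian (fp_functors (stable_Gprj_cat L))].

(* 0 -> (Q -> O)_p1 -> (Q -> P)_(i0 p1) (+) (O -> O)_1 -> (O -> P)_i0 -> 0 *)
Section Sequence.
Variables (C : preadditive) (Q O P : C) (p1 : phom Q O) (i0 : phom O P).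

Definition Hobj (A B : C) (f : phom A B) : mor_cat C := MorObj f.

Fact phi1_comm : i0 \oh p1 = (i0 \oh p1) \oh hid Q.
Proof. by rewrite hcompf1. Qed.
Fact phi2_comm : hid O \oh p1 = hid O \oh p1.
Proof. by []. Qed.
Fact psi1_comm : hid P \oh (i0 \oh p1) = i0 \oh p1.
Proof. by rewrite hcomp1f. Qed.
Fact psi2_comm : (- i0) \oh hid O = i0 \oh (- hid O).
Proof. by rewrite hcompNl hcompNr. Qed.

Definition phi1 : phom (Hobj p1) (Hobj (i0 \oh p1)) :=
  @mkmor C (Hobj p1) (Hobj (i0 \oh p1)) (hid Q) i0 phi1_comm.
Definition phi2 : phom (Hobj p1) (Hobj (hid O)) :=
  @mkmor C (Hobj p1) (Hobj (hid O)) p1 (hid O) phi2_comm.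
Definition psi1 : phom (Hobj (i0 \oh p1)) (Hobj i0) :=
  @mkmor C (Hobj (i0 \oh p1)) (Hobj i0) p1 (hid P) psi1_comm.
Definition psi2 : phom (Hobj (hid O)) (Hobj i0) :=
  @mkmor C (Hobj (hid O)) (Hobj i0) (- hid O) (- i0) psi2_comm.

End Sequence.

(* Main.v *)
(* Modulo projectives, semisimplicity of mod-(stable Gprj) makes every map von *)
(* Neumann regular: the cokernel of Hom(-, f) is projective, hence splits off, *)
(* and by Yoneda f = f g f for some g.  Write O for the syzygy of A.  Maps     *)
(* from O to projectives extend along i0, so endomorphisms of O induce         *)
(* endomorphisms of A, and Fitting's lemma on A shows that O has only trivial  *)
(* stable idempotents.  A map (a, b) from t : U -> V to i0 lifts to the middle *)
(* term iff a is stably of the form c t; otherwise regularity of t and of      *)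
(* a (1 - s t) yields g : O -> U with a g = 1 and t g = 0 stably, which        *)
(* extends to a section of (a, b), because an endomorphism of i0 that is       *)
(* stably the identity on O is invertible.  The left-hand side is dual, and    *)
(* minimality holds because every map between the middle term and an end term  *)
(* gives, after composition, an endomorphism that is stably zero on O.         *)

Require Import Defs.
From mathcomp Require Import all_boot all_algebra ring_quotient boolp.
From HB Require Import structures.

Set Implicit Arguments.
Unset Strict Implicit.
Unset Printing Implicit Defensive.

Import GRing.Theory.
Local Open Scope ring_scope.

(** Write O for the syzygy of A. Everything is decided in the stable category, where semisimplicity
    makes maps von Neumann regular: the cokernel of Hom(-, f) is projective, hence splits off, and
    Yoneda turns the section into g with f = f g f ([semisimple_regular], [stable_regular]). This
    applies to O because O is again Gorenstein projective ([Gprj_cover_kernel]). Moreover maps from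
    O to projectives extend along i0 ([dual_exact_projective]), so an endomorphism of O extends to P
    and descends to A; Fitting's lemma on A ([indecomposable_local]) then leaves O with no stable
    idempotents but 0 and 1 ([syzygy_stable_idempotent]).

    Together these give a dichotomy ([stable_factor_right]): for t : U -> V and a : U -> O, either a
    factors stably through t, or some g : O -> U has a g = 1 and t g = 0 stably. In the first case a
    morphism from t to i0 lifts to the middle term by explicit formulas. In the second, g extends to
    a morphism from i0 to t, and the composite endomorphism of i0 is stably the identity on O, hence
    invertible ([inflation_endo_iso]): the given morphism is a split epimorphism. The left-hand side
    is dual, with p1 in place of i0 ([stable_factor_left], [deflation_endo_iso]).

    For minimality, exactness writes an endomorphism fixing the row as 1 + col w, and Jacobson's
    lemma [iso_1Dba] trades it for 1 + w col on an end term, where w col is stably zero on O; the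
    column is treated alike. An idempotent of the object i0 p1 induces one of A, which is 0 or 1,
    and the two projective covers carry this back to P and Q. *)

(** * Zero objects and Jacobson's lemma in preadditive categories *)

Section Preadditive.
Variable C : preadditive.
Implicit Types X Y Z : C.

Lemma zero_objectP X : zero_object X <-> hid X = 0.
Proof.
split=> [/(_ X)[_ [f [_ fu]]] | X0 Y].
  by rewrite -(fu (hid X) I) -(fu 0 I).
split; exists 0; split=> // g _; first by rewrite -[g]hcomp1f X0 hcomp0l.
by rewrite -[g]hcompf1 X0 hcomp0r.
Qed.

Lemma zero_morphismP (Z : C) : zero_object Z ->
  forall X Y (f : phom X Y), @zero_morphism C X Y f <-> f = 0.
Proof.
move=> Z0 X Y f; split=> [[T [/zero_objectP T0 [a [b ->]]]] | ->].
  by rewrite /= -[a]hcomp1f T0 hcomp0l hcomp0r.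
by exists Z; split=> //; exists 0, 0; rewrite /= hcomp0l.
Qed.

Lemma isoP X Y (f : phom X Y) (g : phom Y X) :
  g \oh f = hid X -> f \oh g = hid Y -> @isomorphism C X Y f.
Proof. by exists g. Qed.

Lemma iso_inv X Y (f : phom X Y) : @isomorphism C X Y f ->
  exists g : phom Y X, g \oh f = hid X /\ f \oh g = hid Y.
Proof. by []. Qed.

(** Jacobson's lemma: if c inverts 1 + a b, then 1 - b c a inverts 1 + b a. It moves invertibility
    from an end term of the sequence to the middle term. *)
Lemma iso_1Dba X Y (a : phom X Y) (b : phom Y X) :
  @isomorphism C Y Y (hid Y + a \oh b) -> @isomorphism C X X (hid X + b \oh a).
Proof.
case=> c [/= c1 c2]; exists (hid X - b \oh c \oh a) => /=.
have e1 : c \oh a \oh b = hid Y - c.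
  by rewrite -hcompA -c1 hcompDr hcompf1 [c + _]addrC addrK.
have e2 : a \oh b \oh c = hid Y - c.
  by rewrite -c2 hcompDl hcomp1f [c + _]addrC addrK.
split.
  rewrite hcompBl !hcompDr !hcomp1f hcompf1.
  have -> : b \oh c \oh a \oh (b \oh a) = b \oh a - b \oh c \oh a.
    have -> : b \oh c \oh a \oh (b \oh a) = b \oh (c \oh a \oh b) \oh a.
      by rewrite !hcompA.
    by rewrite e1 hcompBr hcompBl hcompf1.
by rewrite subrKC addrK.
rewrite hcompBr !hcompDl !hcompf1 hcomp1f.
have -> : b \oh a \oh (b \oh c \oh a) = b \oh a - b \oh c \oh a.
  have -> : b \oh a \oh (b \oh c \oh a) = b \oh (a \oh b \oh c) \oh a.
    by rewrite !hcompA.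
  by rewrite e2 hcompBr hcompBl hcompf1.
by rewrite subrKC addrK.
Qed.

End Preadditive.

(** * Finitely generated modules: liftings, images, splitting of idempotents *)

Section Modules.
Variable L : nzRingType.
Local Notation mod_L := (mod_cat L).
Implicit Types K M N P X Y Z : mod_L.

Lemma hcE X Y Z (g : phom Y Z) (f : phom X Y) x : (g \oh f) x = g (f x).
Proof. by []. Qed.
Lemma hDE X Y (f g : phom X Y) x : (f + g) x = f x + g x.
Proof. by []. Qed.
Lemma hNE X Y (f : phom X Y) x : (- f) x = - f x.
Proof. by []. Qed.
Lemma h0E X Y x : (0 : phom X Y) x = 0.
Proof. by []. Qed.
Lemma h1E X x : (hid X) x = x.
Proof. by []. Qed.

Definition hE := (hcE, hDE, hNE, h0E, h1E).

Lemma homZ X Y (f : phom X Y) a x : f (a *: x) = a *: f x.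
Proof. exact: linearZ_LR. Qed.

Lemma homB X Y (f : phom X Y) x y : f (x - y) = f x - f y.
Proof. exact: raddfB. Qed.

Lemma hom0 X Y (f : phom X Y) : f 0 = 0.
Proof. exact: raddf0. Qed.

Lemma hom_sum X Y (f : phom X Y) m (F : 'I_m -> X) :
  f (\sum_(i < m) F i) = \sum_(i < m) f (F i).
Proof. exact: raddf_sum. Qed.

Lemma hom_ext X Y (f g : phom X Y) : (forall x, f x = g x) -> f = g.
Proof. exact: linear_ext. Qed.

Lemma hom_congr X Y (f g : phom X Y) : f = g -> forall x, f x = g x.
Proof. by move->. Qed.

Lemma hom_inj X Y (f : phom X Y) : (forall x, f x = 0 -> x = 0) -> injective f.
Proof.
move=> f0 x y /eqP; rewrite -subr_eq0 -homB => /eqP /f0 /eqP.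
by rewrite subr_eq0 => /eqP.
Qed.

Lemma iso_surj X Y (f : phom X Y) : @isomorphism mod_L X Y f -> surj f.
Proof. by case=> g [_ fg] y; exists (g y); exact: (hom_congr fg). Qed.

Lemma surj_comp X Y Z (g : phom Y Z) (f : phom X Y) :
  surj g -> surj f -> surj (g \oh f).
Proof.
by move=> gs fs z; have [y <-] := gs z; have [x <-] := fs y; exists x.
Qed.

Lemma surj_epi X Y Z (p : phom X Y) (f g : phom Y Z) :
  surj p -> f \oh p = g \oh p -> f = g.
Proof.
move=> ps e; apply: hom_ext => y; have [x <-] := ps y.
exact: (hom_congr e).
Qed.

Lemma inj_mono X Y Z (i : phom Y Z) (f g : phom X Y) :
  injective i -> i \oh f = i \oh g -> f = g.
Proof. by move=> ii e; apply: hom_ext => x; apply: ii; apply: (hom_congr e). Qed.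

Lemma lift_mono K M T (i : phom K M) (f : phom T M) :
  injective i -> (forall x, exists y, i y = f x) -> exists g : phom T K, i \oh g = f.
Proof.
move=> ii fP; have [g gK] := choice fP.
(* The pointwise choice is linear because preimages under an injective map are unique. *)
have gl : linear g by move=> a x y; apply: ii; rewrite linearP !gK linearP.
pose h : {linear T -> K} := HB.pack g (GRing.isLinear.Build _ _ _ _ _ gl).
by exists h; apply: hom_ext => x; rewrite /= gK.
Qed.

Lemma lift_kernel K M N T (i : phom K M) (p : phom M N) (f : phom T M) :
  exact_sequence i p -> p \oh f = 0 -> exists g : phom T K, i \oh g = f.
Proof.
case=> ii _ ip pf0; apply: lift_mono => // x.
by apply/ip; apply: (hom_congr pf0).
Qed.

Lemma factor_cokernel K M N T (i : phom K M) (p : phom M N) (f : phom M T) :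
  exact_sequence i p -> f \oh i = 0 -> exists g : phom N T, g \oh p = f.
Proof.
case=> ii ps ip fi0.
have fK x y : p x = p y -> f x = f y.
  move=> e; have /ip [z zE] : p (x - y) = 0 by rewrite raddfB /= e subrr.
  apply/eqP; rewrite -subr_eq0 -raddfB -zE; apply/eqP; exact: (hom_congr fi0).
have [s sK] := choice ps.
have gl : linear (f \o s).
  by move=> a x y; rewrite /= -linearP; apply: fK; rewrite linearP !sK.
pose h : {linear N -> T} := HB.pack (f \o s) (GRing.isLinear.Build _ _ _ _ _ gl).
by exists h; apply: hom_ext => x; apply: fK; rewrite sK.
Qed.

Section Image.
Variables (X Y : mod_L) (f : phom X Y).

Definition im_pred : pred Y := fun y => `[< exists x, f x = y >].

Fact im_closed : GRing.submod_closed im_pred.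
Proof.
split; first by apply/asboolP; exists 0; rewrite raddf0.
move=> a _ _ /asboolP [x <-] /asboolP [y <-].
by apply/asboolP; exists (a *: x + y); rewrite linearP.
Qed.
HB.instance Definition _ := GRing.isSubmodClosed.Build L^c Y im_pred im_closed.

Record im_sort := ImSort { im_val :> Y; _ : im_pred im_val }.
HB.instance Definition _ := [isSub for im_val].
HB.instance Definition _ := [Choice of im_sort by <:].
HB.instance Definition _ := [SubChoice_isSubLmodule of im_sort by <:].

Fact im_fg : finitely_generated im_sort.
Proof.
case: (modr_fg X) => n [e He].
have fP x : im_pred (f x) by apply/asboolP; exists x.
exists n, (fun i => ImSort (fP (e i))) => -[y yP].
case: (asboolP _ yP) => x xE; have [c cE] := He x.
exists c; apply: val_inj; rewrite raddf_sum /= -xE cE raddf_sum.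
by apply: eq_bigr => i _; exact: homZ.
Qed.
Definition im : mod_L := Modr im_fg.

Definition im_out_fun (x : X) : im_sort :=
  ImSort (introT (asboolP _) (ex_intro _ x erefl) : im_pred (f x)).
Fact im_out_linear : linear im_out_fun.
Proof. by move=> a x y; apply: val_inj; rewrite /= linearP. Qed.
HB.instance Definition _ :=
  GRing.isLinear.Build L^c X im_sort *:%R im_out_fun im_out_linear.

Definition im_out : phom X im := im_out_fun : {linear _ -> _}.
Definition im_in : phom im Y := (val : im_sort -> Y) : {linear _ -> _}.

Lemma im_factor : im_in \oh im_out = f.
Proof. exact: hom_ext. Qed.
Lemma im_in_inj : injective im_in.
Proof. exact: val_inj. Qed.
Lemma im_out_surj : surj im_out.
Proof.
by move=> -[y yP]; case: (asboolP _ yP) => x xE; exists x; apply: val_inj.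
Qed.

End Image.

(** The image of e is a quotient of X, hence finitely generated, so the idempotent splits inside the
    category. *)
Lemma split_idempotent X (e : phom X X) : e \oh e = e ->
  exists I (j : phom I X) (q : phom X I), q \oh j = hid I /\ j \oh q = e.
Proof.
move=> ee; exists (im e), (im_in e), (im_out e); split; last exact: im_factor.
apply: (inj_mono (@im_in_inj _ _ e)); apply: (surj_epi (@im_out_surj _ _ e)).
by rewrite hcompA im_factor -hcompA im_factor ee hcompf1 im_factor.
Qed.

Lemma module_zero_object : exists Z : mod_L, zero_object Z.
Proof.
pose R := regular_module L.
have [I [j [q [qj jq]]]] : exists I (j : phom I R) (q : phom R I),
    q \oh j = hid I /\ j \oh q = 0 by apply: split_idempotent; rewrite hcomp0l.
exists I; apply/zero_objectP.
by rewrite -qj -[j]hcompf1 -qj (hcompA j) jq hcomp0l hcomp0r.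
Qed.

Lemma split_idempotent_biproduct X (e : phom X X) : e \oh e = e ->
  exists X1 X2 (j1 : phom X1 X) (j2 : phom X2 X) (q1 : phom X X1) (q2 : phom X X2),
  [/\ is_biproduct j1 j2 q1 q2, j1 \oh q1 = e & j2 \oh q2 = hid X - e].
Proof.
move=> ee; have [X1 [j1 [q1 [qj1 jq1]]]] := split_idempotent ee.
have ee' : (hid X - e) \oh (hid X - e) = hid X - e.
  by rewrite hcompBl !hcompBr !hcomp1f hcompf1 ee subrr subr0.
have [X2 [j2 [q2 [qj2 jq2]]]] := split_idempotent ee'.
exists X1, X2, j1, j2, q1, q2; split=> //; split=> //.
- rewrite -[q1]hcomp1f -qj1 -[j2]hcompf1 -qj2 -!hcompA (hcompA j2) jq2 (hcompA j1).
  by rewrite jq1 (hcompA e) hcompBr hcompf1 ee subrr hcomp0l hcomp0r.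
- rewrite -[q2]hcomp1f -qj2 -[j1]hcompf1 -qj1 -!hcompA (hcompA j1) jq1 (hcompA j2).
  by rewrite jq2 (hcompA _ e) hcompBl hcomp1f ee subrr hcomp0l hcomp0r.
- by rewrite jq1 jq2 addrC subrK.
Qed.

Lemma indecomposable_idempotent X (e : phom X X) :
  @indecomposable mod_L X -> e \oh e = e -> e = 0 \/ e = hid X.
Proof.
move=> [_ Xi] /split_idempotent_biproduct [X1 [X2 [j1 [j2 [q1 [q2 [b e1 e2]]]]]]].
case: (Xi _ _ _ _ _ _ b) => /zero_objectP X0.
  by left; rewrite -e1 -[q1]hcomp1f X0 hcomp0l hcomp0r.
right; apply/eqP; rewrite eq_sym -subr_eq0 -e2.
by rewrite -[q2]hcomp1f X0 hcomp0l hcomp0r.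
Qed.

Lemma idempotent_surj X (e : phom X X) : e \oh e = e -> surj e -> e = hid X.
Proof. by move=> ee es; apply: (surj_epi es); rewrite hcomp1f. Qed.

Section ShortExact.
Variables (K P M : mod_L) (i : phom K P) (p : phom P M).
Hypothesis ip : exact_sequence i p.

Lemma exact_comp0 : p \oh i = 0.
Proof. by case: ip => _ _ e; apply: hom_ext => x; apply/e; exists x. Qed.

Lemma exact_surj : surj p. Proof. by case: ip. Qed.
Lemma exact_inj : injective i. Proof. by case: ip. Qed.

End ShortExact.

End Modules.

(** * Fitting's lemma over Artin algebras *)

Section Artinian.
Variable k : comNzRingType.

Lemma chain_le (T : Type) (N : nat -> T -> Prop) :
  (forall n x, N n.+1 x -> N n x) ->
  forall m n x, (m <= n)%N -> N n x -> N m x.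
Proof.
move=> dec m n x /subnK <-; elim: (n - m)%N => // d IH Nx.
by apply: IH; apply: dec.
Qed.

(** A chain stabilises as soon as its image in W and its trace on the kernel of f do: an element is
    corrected by one of the smaller submodule with the same image, and the difference lies in the
    kernel. *)
Lemma artinian_extension (V W : lmodType k) (f : {linear V -> W})
    (N : nat -> V -> Prop) :
  artinian_module W ->
  (forall n, is_submodule (N n)) -> (forall n x, N n.+1 x -> N n x) ->
  (exists n0, forall n, (n0 <= n)%N -> forall x, f x = 0 -> N n0 x -> N n x) ->
  exists n0, forall n, (n0 <= n)%N -> forall x, N n0 x -> N n x.
Proof.
move=> Wa Nsub Ndec [n1 n1P].
have [||n2 n2P] := Wa (fun n w => exists2 x, N n x & f x = w).
- move=> n; have [N0 ND NZ] := Nsub n; split.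
  + by exists 0; rewrite ?raddf0.
  + move=> _ _ [x Nx <-] [y Ny <-]; exists (x + y); rewrite ?raddfD //.
    exact: ND.
  + by move=> a _ [x Nx <-]; exists (a *: x); rewrite ?linearZ //; apply: NZ.
- by move=> n _ [x Nx <-]; exists x => //; apply: Ndec.
exists (maxn n1 n2) => n; rewrite geq_max => /andP [le1 le2] x Nx.
have [|y Ny fy] := n2P n le2 (f x).
  by exists x => //; apply: (chain_le Ndec) Nx; apply: leq_maxr.
have [N0 ND NZ] := Nsub n; rewrite -[x](subrK y); apply: ND => //.
apply: n1P => //; first by rewrite raddfB /= fy subrr.
have [_ ND1 NZ1] := Nsub n1; apply: ND1.
  by apply: (chain_le Ndec) Nx; apply: leq_maxl.
by rewrite -scaleN1r; apply: NZ1; apply: (chain_le Ndec) Ny.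
Qed.

(** Induction on the number r of maps on which the chain may still be nonzero, one map being removed
    at a time by [artinian_extension]. The coordinates of a finite power of W are the intended
    maps. *)
Lemma artinian_joint (V W : lmodType k) m (f : 'I_m -> {linear V -> W}) :
  artinian_module W -> (forall x, (forall i, f i x = 0) -> x = 0) ->
  artinian_module V.
Proof.
move=> Wa finj.
suff H r (N : nat -> V -> Prop) : (r <= m)%N ->
  (forall n, is_submodule (N n)) -> (forall n x, N n.+1 x -> N n x) ->
  (forall n x (i : 'I_m), (r <= i)%N -> N n x -> f i x = 0) ->
  exists n0, forall n, (n0 <= n)%N -> forall x, N n0 x -> N n x.
  by move=> N Ns Nd; apply: (H m) => // n x i; rewrite leqNgt ltn_ord.
elim: r N => [|r IH] N rm Ns Nd Nf.
  exists 0%N => n _ x Nx; rewrite (finj x) => [|i]; first by case: (Ns n).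
  exact: Nf Nx.
apply: (artinian_extension (f := f (Ordinal rm))) => //.
have [||||n0 n0P] := IH (fun n x => N n x /\ f (Ordinal rm) x = 0).
- exact: ltnW.
- move=> n; have [N0 ND NZ] := Ns n; split; first by rewrite raddf0.
    move=> x y [Nx fx] [Ny fy]; split; first exact: ND.
    by rewrite raddfD /= fx fy addr0.
  by move=> a x [Nx fx]; split; [exact: NZ | rewrite linearZ /= fx scaler0].
- by move=> n x [Nx fx]; split=> //; apply: Nd.
- move=> n x i; rewrite leq_eqVlt => /orP [/eqP e | lt] [Nx fx].
    by rewrite -fx; congr (f _ x); apply: val_inj.
  exact: Nf Nx.
by exists n0 => n le x fx Nx; case: (n0P n le x).
Qed.

Lemma artinian_ffun (W : lmodType k) m :
  artinian_module W -> artinian_module ({ffun 'I_m -> W} : lmodType k).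
Proof.
have el i : linear (fun g : {ffun 'I_m -> W} => g i).
  by move=> a g h; rewrite !ffunE.
pose ev i : {linear {ffun 'I_m -> W} -> W} :=
  HB.pack (fun g : {ffun 'I_m -> W} => g i) (GRing.isLinear.Build _ _ _ _ _ (el i)).
move=> Wa; apply: (artinian_joint (f := ev)) => // g g0.
by apply/ffunP => i; rewrite ffunE; apply: g0.
Qed.

Lemma artinian_fg (M : lmodType k) :
  artinian_module (k^o : lmodType k) -> finitely_generated M ->
  artinian_module M.
Proof.
move=> ka [m [e He]] N Ns Nd.
pose phi (c : {ffun 'I_m -> k^o}) : M := \sum_(i < m) (c i : k) *: e i.
have phiP a c d : phi (a *: c + d) = a *: phi c + phi d.
  rewrite /phi scaler_sumr -big_split; apply: eq_bigr => i _.
  by rewrite !ffunE scalerDl scalerA.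
have phi0 : phi 0 = 0 by rewrite /phi big1 // => i _; rewrite ffunE scale0r.
have [||n0 n0P] := @artinian_ffun _ m ka (fun n c => N n (phi c)).
- move=> n; have [N0 ND NZ] := Ns n; split; first by rewrite phi0.
    by move=> c d Nc Nd'; have := phiP 1 c d; rewrite !scale1r => ->; apply: ND.
  move=> a c Nc; have := phiP a c 0; rewrite phi0 !addr0 => ->; exact: NZ.
- by move=> n c; apply: Nd.
exists n0 => n le x; have [c ->] := He x.
have -> : \sum_(i < m) c i *: e i = phi [ffun i => c i].
  by apply: eq_bigr => i _; rewrite ffunE.
exact: n0P.
Qed.

End Artinian.

Section Algebra.
Variables (k : comNzRingType) (L : algType k).
Implicit Types X Y : mod_cat L.

(** An alias that carries the k-module structure obtained by restriction of scalars, apart from the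
    L^c-structure of X. *)
Definition restr X : Type := X.

Section Restriction.
Variable X : mod_cat L.
HB.instance Definition _ := GRing.Zmodule.on (restr X).

Definition rscale (c : k) (x : restr X) : restr X := (c%:A : L^c) *: (x : X).

Fact rscaleA a b x : rscale a (rscale b x) = rscale (a * b) x.
Proof.
rewrite /rscale scalerA; congr (_ *: _).
change ((b%:A : L) * a%:A = (a * b)%:A).
by rewrite -scalerAl mul1r scalerA mulrC.
Qed.
Fact rscale1 : left_id 1 rscale.
Proof. by move=> x; rewrite /rscale scale1r [LHS]scale1r. Qed.
Fact rscaleDr : right_distributive rscale +%R.
Proof. by move=> a x y; apply: scalerDr. Qed.
Fact rscaleDl x : {morph rscale^~ x : a b / a + b}.
Proof. by move=> a b; rewrite /rscale scalerDl [LHS]scalerDl. Qed.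
HB.instance Definition _ := GRing.Zmodule_isLmodule.Build k (restr X)
  rscaleA rscale1 rscaleDr rscaleDl.

Lemma restr_fg : finitely_generated (L : lmodType k) ->
  finitely_generated (restr X : lmodType k).
Proof.
case=> m [l Hl]; case: (modr_fg X) => n [e He].
pose T : finType := ('I_n * 'I_m)%type.
exists #|T|, (fun r => (l (enum_val r).2 : L^c) *: e (enum_val r).1) => x.
have [a aE] := He x.
have [c cE] := choice (fun j => Hl (a j)).
exists (fun r => c (enum_val r).1 (enum_val r).2).
rewrite -(big_enum_val
  (fun r : T => c r.1 r.2 *: ((l r.2 : L^c) *: e r.1 : restr X))) /=.
rewrite -(pair_big xpredT xpredT
  (fun i j => c i j *: ((l j : L^c) *: e i : restr X))) /= [LHS]aE.
apply: eq_bigr => i _; rewrite [in LHS]cE scaler_suml.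
apply: eq_bigr => j _.
change ((c i j *: l j : L^c) *: e i = ((c i j)%:A : L^c) *: ((l j : L^c) *: e i)).
rewrite scalerA; congr (_ *: _).
by change (c i j *: l j = l j * (c i j)%:A); rewrite -scalerAr mulr1.
Qed.

End Restriction.

Section Endomorphism.
Hypothesis hL : artin_algebra L.
Variables (X : mod_cat L) (t : phom X X).

Fact scalek_linear (c : k) (g : phom X X) :
  linear (fun x : X => (c%:A : L^c) *: g x).
Proof.
move=> a x y; rewrite linearP scalerDr !scalerA; congr (_ *: _ + _).
have central (b : L) : b * c%:A = c%:A * b.
  by rewrite -scalerAr -scalerAl mulr1 mul1r.
exact: central.
Qed.

Definition scalek (c : k) (g : phom X X) : phom X X :=
  (HB.pack (fun x : X => (c%:A : L^c) *: g x)
    (GRing.isLinear.Build _ _ _ _ _ (scalek_linear c g)) : {linear X -> X}).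

Definition hpow n : phom X X := iter n (hcomp t) (hid X).

Lemma hpowSr n : hpow n.+1 = hpow n \oh t.
Proof.
elim: n => [|n IH]; first exact: etrans (hcompf1 t) (esym (hcomp1f t)).
by rewrite -[hpow n.+2]/(t \oh hpow n.+1) [in LHS]IH hcompA.
Qed.

Lemma hpowD m n : hpow (m + n) = hpow m \oh hpow n.
Proof.
elim: m => [|m IH]; first exact: esym (hcomp1f _).
by rewrite -[hpow _]/(t \oh hpow (m + n)) IH hcompA.
Qed.

Lemma hpow_comm (g : phom X X) n :
  g \oh t = t \oh g -> g \oh hpow n = hpow n \oh g.
Proof.
move=> gt; elim: n => [|n IH]; first exact: etrans (hcompf1 g) (esym (hcomp1f g)).
by rewrite -[hpow n.+1]/(t \oh hpow n) hcompA gt -!hcompA IH.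
Qed.

(* DCC on the k-submodules {g t^n : g commutes with t} of End X, which embeds *)
(* into a power of X by evaluation at generators.                             *)
Lemma endo_power_stable : exists n, forall m, (n <= m)%N ->
  exists g : phom X X, g \oh t = t \oh g /\ hpow n = g \oh hpow m.
Proof.
case: hL => ka Lfg; case: (modr_fg X) => m [e He].
have Xa : artinian_module (restr X : lmodType k).
  by apply: artinian_fg => //; apply: restr_fg.
pose N n (F : {ffun 'I_m -> restr X}) := exists g : phom X X,
  g \oh t = t \oh g /\ forall i, F i = (g \oh hpow n) (e i).
have [|n F [g [gt gE]]|n nP] := @artinian_ffun k (restr X) m Xa N.
- move=> n; split.
  + by exists 0; rewrite hcomp0l hcomp0r; split=> // i; rewrite ffunE.
  + move=> F G [f [ft fE]] [g [gt gE]]; exists (f + g); split.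
      by rewrite hcompDl hcompDr ft gt.
    by move=> i; rewrite ffunE fE gE.
  + move=> a F [f [ft fE]]; exists (scalek a f); split.
      apply: hom_ext => x; rewrite !hE /= [RHS]linearZ_LR; congr (_ *: _).
      exact: (hom_congr ft).
    by move=> i; rewrite ffunE fE.
- exists (g \oh t); split; first by rewrite {1}gt -hcompA.
  by move=> i; rewrite gE -hcompA.
exists n => p np; have [|g [gt gE]] := nP p np [ffun i => hpow n (e i)].
  by exists (hid X); rewrite hcomp1f hcompf1; split=> // i; rewrite ffunE hcomp1f.
exists g; split=> //; apply: hom_ext => x; have [c ->] := He x.
rewrite !hom_sum; apply: eq_bigr => i _; rewrite !homZ; congr (_ *: _).
by have := gE i; rewrite ffunE.
Qed.

(** Stability gives t^n = g t^(n+1) with g commuting with t; cancelling t^n makes g the inverse. For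
    surjective t the cancellation is on the other side. *)
Lemma inj_endo_iso : injective t -> @isomorphism (mod_cat L) X X t.
Proof.
move=> ti; have [n /(_ n.+1 (leqnSn n)) [g [gt hE]]] := endo_power_stable.
have hi : injective (hpow n).
  by elim: n {hE} => [|n IH] x y // /ti; apply: IH.
have tg : t \oh g = hid X.
  by apply: (inj_mono hi); rewrite hcompf1 hcompA -hpowSr -hpow_comm.
by apply: (@isoP _ _ _ t g) => //; rewrite gt.
Qed.

Lemma surj_endo_iso : surj t -> @isomorphism (mod_cat L) X X t.
Proof.
move=> ts; have [n /(_ n.+1 (leqnSn n)) [g [gt hE]]] := endo_power_stable.
have hs : surj (hpow n).
  elim: n {hE} => [|n IH] x; first by exists x.
  by have [y <-] := ts x; have [z <-] := IH y; exists z.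
have tg : g \oh t = hid X by apply: (surj_epi hs); rewrite hcomp1f -hcompA.
by apply: (@isoP _ _ _ t g) => //; rewrite -gt.
Qed.

End Endomorphism.

(** Fitting's lemma. With h = t^n = g h h and g commuting with h, the map g h is idempotent, hence 0
    or 1. If it is 0, then t is nilpotent and 1 - t is injective; if it is 1, then t is
    injective. *)
Lemma indecomposable_local (X : mod_cat L) (t : phom X X) :
  artin_algebra L -> @indecomposable (mod_cat L) X ->
  @isomorphism (mod_cat L) X X t \/ @isomorphism (mod_cat L) X X (hid X - t).
Proof.
move=> hL Xi; have [n tn] := endo_power_stable hL t.
pose h := hpow t n; have [g [gt hg]] := tn _ (leq_addr n n).
rewrite hpowD -/h in hg; have gh : g \oh h = h \oh g by apply: hpow_comm.
have ghi : (g \oh h) \oh (g \oh h) = g \oh h.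
  by rewrite -hcompA (hcompA h) -gh -(hcompA g h h) -hg.
have [e0 | e1] := indecomposable_idempotent Xi ghi; [right | left].
  have h0 : h = 0 by rewrite hg hcompA e0 hcomp0l.
  apply: inj_endo_iso => //; apply: hom_inj => x.
  rewrite !hE => /eqP; rewrite subr_eq0 => /eqP tx.
  rewrite -[RHS](hom_congr h0 x) /h; elim: (n) => // m IH.
  by rewrite [RHS]hcE -IH.
have [g' [_ hg']] := tn _ (leqnSn n).
apply: inj_endo_iso => //; apply: hom_inj => x tx.
by rewrite -[x]h1E -e1 hcE /h hg' hpowSr !hcE tx !hom0.
Qed.

End Algebra.

(** * Gorenstein projective modules *)

Section Gorenstein.
Variable L : nzRingType.
Local Notation mod_L := (mod_cat L).
Local Notation R := (regular_module L).
Implicit Types K M N P X Y Z : mod_L.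

Lemma exact_inj0 K P M (i : phom K P) (p : phom P M) x :
  exact_sequence i p -> i x = 0 -> x = 0.
Proof. by case=> ii _ _ ix; apply: ii; rewrite ix hom0. Qed.

(** The last condition says that Hom(-, R) keeps the sequence exact, that is, Ext^1(M, R) = 0. *)
Definition dual_exact K P M (i : phom K P) (p : phom P M) : Prop :=
  [/\ exact_sequence i p, projective_module P
    & forall f : phom K R, exists g : phom P R, g \oh i = f].

(** A coinductive criterion: when each member of S has a syzygy and a cosyzygy in S through dual
    exact sequences, splicing these in both directions yields a totally acyclic complex. It replaces
    the construction of complexes by that of single sequences. *)
Lemma Gprj_of_class (S : mod_L -> Prop) :
  (forall M, S M -> exists K P (i : phom K P) (p : phom P M),
     dual_exact i p /\ S K) ->
  (forall M, S M -> exists N P (i : phom M P) (p : phom P N),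
     dual_exact i p /\ S N) ->
  forall M, S M -> Gprj M.
Proof.
move=> Sl Sr M SM.
have [prev prevP] : {prev : {M | S M} -> {M | S M} & forall T, exists P
    (i : phom (sval (prev T)) P) (p : phom P (sval T)), dual_exact i p}.
  apply: (@choice _ _ (fun T U => exists P
    (i : phom (sval U) P) (p : phom P (sval T)), dual_exact i p)) => -[X SX].
  by have [K [P [i [p [h SK]]]]] := Sl X SX; exists (exist S K SK), P, i, p.
have [next nextP] : {next : {M | S M} -> {M | S M} & forall T, exists P
    (i : phom (sval T) P) (p : phom P (sval (next T))), dual_exact i p}.
  apply: (@choice _ _ (fun T U => exists P
    (i : phom (sval T) P) (p : phom P (sval U)), dual_exact i p)) => -[X SX].
  by have [K [P [i [p [h SK]]]]] := Sr X SX; exists (exist S K SK), P, i, p.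
pose M0 := exist S M SM.
(* The syzygy in degree n, with M in degree 0; [Negz m] stands for -(m+1), hence the m.+1 backward
   steps. *)
pose F (n : int) : mod_L := sval (match n with
  | Posz m => iter m next M0 | Negz m => iter m.+1 prev M0 end).
have step n : exists D : {P : mod_L & (phom (F n) P * phom P (F (n + 1)%R))%type},
    dual_exact (projT2 D).1 (projT2 D).2.
  (* The degree n + 1 is made a variable so that it can be rewritten to a constructor of [int], on
     which F computes. *)
  have st m : m = n + 1 -> exists P (i : phom (F n) P) (p : phom P (F m)),
      dual_exact i p.
    case: n => [n|[|n]] ->.
    - have -> : Posz n + 1 = n.+1 by rewrite addrC -intS.
      exact: nextP.
    - exact: (prevP M0).
    - have -> : Negz n.+1 + 1 = Negz n by rewrite !NegzE (intS n.+1) opprD addrC addNKr.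
      exact: (prevP (iter n.+1 prev M0)).
  have [P [i [p h]]] := st _ erefl.
  by exists (existT _ P (i, p)).
pose D n := projT1 (cid (step n)).
pose P n := projT1 (D n).
pose i n : phom (F n) (P n) := (projT2 (D n)).1.
pose p n : phom (P n) (F (n + 1)) := (projT2 (D n)).2.
have h n : dual_exact (i n) (p n) := projT2 (cid (step n)).
have i0 n x : i n x = 0 -> x = 0 by case: (h n) => e _ _; apply: exact_inj0 e.
pose d n : phom (P n) (P (n + 1)) := i (n + 1) \oh p n.
exists P, d; split.
- by move=> n; case: (h n).
- move=> n x; case: (h (n + 1)) (h n) => [[_ _ e] _ _] [[_ ps _] _ _]; split.
    move=> /i0 /e [z <-]; have [y <-] := ps z; by exists y.
  case=> y <-; rewrite hcE; have /e -> : exists z, i (n + 1) z = d n y.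
    by exists (p n y).
  by rewrite hom0.
- move=> n u; have [[ii ps _] _ _] := h n; split=> [u0 | [v <-]].
    have ui : u \oh i (n + 1) = 0.
      by apply: (surj_epi ps); rewrite -hcompA u0 hcomp0l.
    have [ex _ _] := h (n + 1); have [u' u'E] := factor_cokernel ex ui.
    have [_ _ /(_ u') [v vE]] := h (n + 1 + 1).
    by exists v; rewrite hcompA vE.
  have [ex _ _] := h (n + 1).
  by rewrite -!hcompA (hcompA (p _)) (exact_comp0 ex) hcomp0l !hcomp0r.
- exists 0, (i 0); case: (h 0) => [[ii ps e] _ _]; split=> // x.
  split=> [/i0 /e // | /e px].
  by rewrite hcE px hom0.
Qed.

Section Complex.
Variables (P : int -> mod_L) (d : forall n : int, phom (P n) (P (n + 1))).
Arguments d : clear implicits.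
Hypotheses (hP : forall n, projective_module (P n)) (dd : complex_acyclic d)
  (dd' : dual_acyclic d).

Lemma Gprj_image n : Gprj (im (d n)).
Proof.
exists P, d; split=> //; exists (n + 1), (im_in (d n)); split.
  exact: im_in_inj.
move=> x; split=> [/dd [y <-] | [y <-]].
  by exists (im_out (d n) y); rewrite -hcE im_factor.
by apply/dd; have [z <-] := @im_out_surj _ _ _ _ y; exists z; rewrite -hcE im_factor.
Qed.

(** A functional vanishing on the kernel of d n is a cocycle of the dual complex. Dual acyclicity is
    phrased at degrees of the form m + 1, hence the reindexing. *)
Lemma dual_lift n (u : phom (P n) R) : (forall x, d n x = 0 -> u x = 0) ->
  exists v : phom (P (n + 1)) R, v \oh d n = u.
Proof.
have [m nE] : exists m : int, n = m + 1 by exists (n - 1); rewrite subrK.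
move: u; rewrite {n}nE => u u0; apply: (dd' _).1.
by apply: hom_ext => x; apply/u0/dd; exists x.
Qed.

Lemma image_dual n (f : phom (im (d n)) R) :
  exists g : phom (P (n + 1)) R, g \oh im_in (d n) = f.
Proof.
have [x dx | v vE] := @dual_lift n (f \oh im_out (d n)).
  rewrite hcE; have -> : im_out (d n) x = 0 by apply: val_inj.
  by rewrite hom0.
exists v; apply: (surj_epi (@im_out_surj _ _ _ (d n))).
by rewrite -hcompA im_factor vE.
Qed.

Variables (n : int) (M : mod_L) (i : phom M (P (n + 1))).
Hypotheses (ii : injective i)
  (iP : forall x : P (n + 1), d (n + 1) x = 0 <-> exists y, i y = x).

Lemma kernel_cover : exists2 p : phom (P n) M, surj p & i \oh p = d n.
Proof.
have [|p pE] := lift_mono (f := d n) ii.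
  by move=> x; apply/iP/dd; exists x.
exists p => // y; have /dd [x xE] : d (n + 1) (i y) = 0 by apply/iP; exists y.
by exists x; apply: ii; rewrite -xE -pE.
Qed.

End Complex.

Lemma Gprj_syzygy M : Gprj M -> exists K P (i : phom K P) (p : phom P M),
  dual_exact i p /\ Gprj K.
Proof.
move=> [P [d [hP dd dd' [n [i [ii iP]]]]]].
have [m nE] : exists m : int, n = m + 1 + 1.
  by exists (n - 1 - 1); rewrite !subrK.
move: i ii iP; rewrite {n}nE => i ii iP.
have [p ps pE] := kernel_cover dd ii iP.
exists (im (d m)), (P (m + 1)), (im_in (d m)), p; split; last exact: Gprj_image.
split=> //; last exact: (image_dual dd dd').
split=> // [|x]; first exact: im_in_inj.
split=> [px | [y <-]].
  have /dd [y <-] : d (m + 1) x = 0 by rewrite -pE hcE px hom0.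
  by exists (im_out (d m) y); rewrite -hcE im_factor.
have [z <-] := @im_out_surj _ _ _ _ y; apply: ii.
by rewrite -(hcE (im_in (d m)) _ z) im_factor -(hcE i p) pE hom0; apply/dd; exists z.
Qed.

Lemma Gprj_cosyzygy M : Gprj M -> exists N P (i : phom M P) (p : phom P N),
  dual_exact i p /\ Gprj N.
Proof.
move=> [P [d [hP dd dd' [n [i [ii iP]]]]]].
have [m nE] : exists m : int, n = m + 1 by exists (n - 1); rewrite subrK.
move: i ii iP; rewrite {n}nE => i ii iP.
have [p ps pE] := kernel_cover dd ii iP.
exists (im (d (m + 1))), (P (m + 1)), i, (im_out (d (m + 1))).
split; last exact: Gprj_image.
split=> //.
  split=> // [|x]; first exact: im_out_surj.
  rewrite -iP; split=> [x0 | x0].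
    by rewrite -(hom_congr (im_factor _)) hcE x0 hom0.
  by apply: (@im_in_inj _ _ _ (d (m + 1))); rewrite -hcE im_factor x0 hom0.
move=> f; have [x dx | v vE] := @dual_lift _ _ dd dd' m (f \oh p).
  by rewrite hcE (_ : p x = 0) ?hom0 //; apply: ii; rewrite -hcE pE dx hom0.
by exists v; apply: (surj_epi ps); rewrite -hcompA pE.
Qed.

Lemma biproduct_exact X1 X2 X (i1 : phom X1 X) (i2 : phom X2 X)
    (p1 : phom X X1) (p2 : phom X X2) :
  is_biproduct i1 i2 p1 p2 -> exact_sequence i1 p2.
Proof.
case=> e1 e2 _ e4 e; split.
- by apply: hom_inj => x ix; rewrite -[x]h1E -e1 hcE ix hom0.
- by move=> y; exists (i2 y); rewrite -hcE e2.
move=> x; split=> [x0 | [y <-]]; last by rewrite -hcE e4.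
by exists (p1 x); rewrite -[RHS]h1E -e !hE x0 hom0 addr0.
Qed.

(** The class of projectives satisfies the criterion by the split sequences M -> M + M -> M. *)
Lemma projective_Gprj P : projective_module P -> Gprj P.
Proof.
apply: Gprj_of_class => M hM; exists M, (dsum M M), (din1 M M), (dpr2 M M);
  have b := dsum_biproduct M M; (split; last by []); split.
all: try exact: biproduct_exact b.
all: try exact: dsum_projective.
all: by move=> f; exists (f \oh dpr1 M M); case: b => e _ _ _ _;
  rewrite -hcompA e hcompf1.
Qed.

Section DirectSumMap.
Variables (X1 X2 Y1 Y2 : mod_L).

Definition dmap (f : phom X1 Y1) (g : phom X2 Y2) : phom (dsum X1 X2) (dsum Y1 Y2) :=
  diag_map (dpr1 X1 X2) (dpr2 X1 X2) (din1 Y1 Y2) (din2 Y1 Y2) f g.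

Lemma dmapE f g x : dmap f g x = (f x.1, g x.2).
Proof. by rewrite /dmap /diag_map !hE; congr pair; rewrite /= ?addr0 ?add0r. Qed.

End DirectSumMap.

Lemma dual_exact_dsum K P M (i : phom K P) (p : phom P M)
    K' P' M' (i' : phom K' P') (p' : phom P' M') :
  dual_exact i p -> dual_exact i' p' -> dual_exact (dmap i i') (dmap p p').
Proof.
move=> [[ii ps ip] hP hi] [[ii' ps' ip'] hP' hi']; split; last 2 first.
- exact: dsum_projective.
- move=> f; have [g gE] := hi (f \oh din1 K K').
  have [g' gE'] := hi' (f \oh din2 K K').
  exists (g \oh dpr1 P P' + g' \oh dpr2 P P').
  have [e1 e2 e3 e4 e] := dsum_biproduct K K'.
  have b := dsum_biproduct P P'.
  rewrite hcompDl -!hcompA (diag_map_pr1 _ _ _ _ b) (diag_map_pr2 _ _ _ _ b).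
  by rewrite !hcompA gE gE' -!hcompA -hcompDr e hcompf1.
split.
- by move=> [x x'] [y y']; rewrite !dmapE => -[/ii <- /ii' <-].
- move=> [y y']; have [x <-] := ps y; have [x' <-] := ps' y'.
  by exists (x, x'); rewrite dmapE.
move=> [x x']; rewrite dmapE; split.
  by case=> /ip [y <-] /ip' [y' <-]; exists (y, y'); rewrite dmapE.
case=> -[y y']; rewrite dmapE => -[<- <-].
by congr pair; [apply/ip; exists y | apply/ip'; exists y'].
Qed.

Lemma Gprj_dsum M N : Gprj M -> Gprj N -> Gprj (dsum M N).
Proof.
move=> hM hN; pose S X := exists M N, [/\ Gprj M, Gprj N & X = dsum M N].
apply: (@Gprj_of_class S); last by exists M, N.
  move=> _ [{hM}M [{hN}N [hM hN ->]]].
  have [K [P [i [p [h hK]]]]] := Gprj_syzygy hM.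
  have [K' [P' [i' [p' [h' hK']]]]] := Gprj_syzygy hN.
  exists (dsum K K'), (dsum P P'), (dmap i i'), (dmap p p').
  by split; [exact: dual_exact_dsum | exists K, K'].
move=> _ [{hM}M [{hN}N [hM hN ->]]].
have [K [P [i [p [h hK]]]]] := Gprj_cosyzygy hM.
have [K' [P' [i' [p' [h' hK']]]]] := Gprj_cosyzygy hN.
exists (dsum K K'), (dsum P P'), (dmap i i'), (dmap p p').
by split; [exact: dual_exact_dsum | exists K, K'].
Qed.

Lemma retract_projective P Q (j : phom Q P) (q : phom P Q) :
  projective_module P -> q \oh j = hid Q -> projective_module Q.
Proof.
move=> hP qj M N e f es; have [h hE] := hP M N e (f \oh q) es.
by exists (h \oh j); rewrite hcompA hE -hcompA qj hcompf1.
Qed.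

(** Comparison with a dual exact sequence K' -> P' -> M: lifting the identity of M both ways gives w
    : K' -> K and c : K -> K' with w c = 1 + x i, x defined on P. Extend f w over P', and correct by
    f x. *)
Lemma exact_dual K P M (i : phom K P) (p : phom P M) :
  Gprj M -> exact_sequence i p -> projective_module P -> dual_exact i p.
Proof.
move=> /Gprj_syzygy [K' [P' [i' [p' [[ex' hP' dual'] _]]]]] ex hP; split=> // f.
have [u uE] := hP' _ _ p p' (exact_surj ex).
have [v vE] := hP _ _ p' p (exact_surj ex').
have [|w wE] := lift_kernel (f := u \oh i') ex.
  by rewrite hcompA uE (exact_comp0 ex').
have [|c cE] := lift_kernel (f := v \oh i) ex'.
  by rewrite hcompA vE (exact_comp0 ex).
have [|x xE] := lift_kernel (f := u \oh v - hid P) ex.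
  by rewrite hcompBr hcompA uE vE hcompf1 subrr.
have wc : w \oh c = hid K + x \oh i.
  apply: (inj_mono (exact_inj ex)); rewrite hcompDr !hcompA wE xE -hcompA cE.
  by rewrite hcompBl hcompA hcompf1 hcomp1f addrC subrK.
have [g gE] := dual' (f \oh w).
exists (g \oh v - f \oh x).
by rewrite hcompBl -!hcompA -cE (hcompA g) gE -hcompA wc hcompDr hcompf1 addrK.
Qed.

(* Since p is a projective cover, P' splits as P + R over M for any projective *)
(* P' onto M with Gorenstein projective kernel K', hence K' = K + R.           *)
Lemma Gprj_cover_kernel K P M (i : phom K P) (p : phom P M) :
  Gprj M -> exact_sequence i p -> projective_cover p -> Gprj K.
Proof.
move=> hM ex [hP ps ess].
pose S X := Gprj X \/ X = K.
apply: (@Gprj_of_class S); last by right.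
  move=> M' [/Gprj_syzygy [K' [P' [i' [p' [h hK']]]]] | ->].
    by exists K', P', i', p'; split=> //; left.
  have [K' [P' [i' [p' [[ex' hP' dual'] hK']]]]] := Gprj_syzygy hM.
  have [K2 [P2 [i2 [p2 [[ex2 hP2 dual2] hK2]]]]] := Gprj_syzygy hK'.
  have [u uE] := hP' _ _ p p' ps.
  have us : surj u by apply: ess; rewrite uE; exact: exact_surj ex'.
  have [s sE] := hP _ _ u (hid P) us.
  have p's : p' \oh s = p by rewrite -uE -hcompA sE hcompf1.
  have [|r rE] := lift_kernel (f := hid P' - s \oh u) ex'.
    by rewrite hcompBr hcompf1 hcompA p's uE subrr.
  have [|c cE] := lift_kernel (f := s \oh i) ex'.
    by rewrite hcompA p's (exact_comp0 ex).
  have [|w wE] := lift_kernel (f := u \oh i') ex.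
    by rewrite hcompA uE (exact_comp0 ex').
  have i'i := exact_inj ex'; have ii := exact_inj ex.
  have wc : w \oh c = hid K.
    by apply: (inj_mono ii); rewrite hcompA wE -hcompA cE hcompA sE hcomp1f hcompf1.
  have [e eE] : exists e, e = r \oh i' by exists (r \oh i').
  have cw : c \oh w = hid K' - e.
    apply: (inj_mono i'i); rewrite hcompA cE -hcompA wE hcompBr hcompf1 eE !hcompA rE.
    by rewrite hcompBl hcomp1f opprB addrC subrK.
  have ee : e \oh e = e.
    have we : w \oh e = 0.
      have -> : e = hid K' - c \oh w by rewrite cw opprB addrC subrK.
      by rewrite hcompBr hcompf1 hcompA wc hcomp1f subrr.
    have : c \oh w \oh e = 0 by rewrite -hcompA we hcomp0r.
    by rewrite cw hcompBl hcomp1f => /eqP; rewrite subr_eq0 => /eqP {1}<-.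
  (* The idempotent e cuts out the complement of K in K'. Since e factors through P', it lifts along
     p2 to an idempotent t of P2 that kills K2; removing the image of t leaves K2 -> P0 -> K, so K2
     is also a syzygy of K. *)
  have [a aE] := hP' _ _ p2 r (exact_surj ex2).
  have [t tE] : exists t, t = a \oh i' \oh e \oh p2 by exists (a \oh i' \oh e \oh p2).
  have pt : p2 \oh t = e \oh p2 by rewrite tE !hcompA aE -eE ee.
  have tt : t \oh t = t.
    by rewrite {1}tE -hcompA pt hcompA -(hcompA _ e e) ee -tE.
  have ttC : (hid P2 - t) \oh (hid P2 - t) = hid P2 - t.
    by rewrite hcompBl !hcompBr !hcomp1f hcompf1 tt subrr subr0.
  have [P0 [j [q [qj jq]]]] := split_idempotent ttC.
  have [x2 _ k2] := ex2.
  have jqi : j \oh q \oh i2 = i2.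
    by rewrite jq hcompBl hcomp1f tE -!hcompA (exact_comp0 ex2) !hcomp0r subr0.
  have p2jq : p2 \oh j \oh q = c \oh w \oh p2.
    by rewrite -hcompA jq hcompBr hcompf1 pt cw hcompBl hcomp1f.
  exists K2, P0, (q \oh i2), (w \oh p2 \oh j); split; last by left.
  split; last 2 first.
  - exact: retract_projective hP2 qj.
  - move=> f; have [g gE] := dual2 f; exists (g \oh j).
    by rewrite -hcompA (hcompA j) jqi.
  split.
  - apply: hom_inj => x qx; apply: (exact_inj0 ex2).
    by rewrite -jqi -hcompA hcE qx hom0.
  - move=> y; have [x xE] := exact_surj ex2 (c y); exists (q x).
    have we : w \oh p2 \oh j \oh q = w \oh p2.
      by rewrite -!hcompA (hcompA p2) p2jq !hcompA wc hcomp1f.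
    by rewrite -hcE we hcE xE -hcE wc.
  move=> y; split=> [wy | [x <-]].
    have /k2 [z zE] : p2 (j y) = 0.
      have -> : p2 (j y) = (c \oh (w \oh p2 \oh j)) y.
        by rewrite !hcompA -p2jq -!hcompA qj hcompf1.
      by rewrite hcE wy hom0.
    by exists z; rewrite hcE zE -hcE qj.
  by rewrite -hcE -!hcompA (hcompA j) jqi (exact_comp0 ex2) hcomp0r.
move=> M' [/Gprj_cosyzygy [K' [P' [i' [p' [h hK']]]]] | ->].
  by exists K', P', i', p'; split=> //; left.
by exists M, P, i, p; split; [exact: exact_dual | left].
Qed.

(** The modules into which maps from K extend include R, are closed under direct sums and pass to
    retracts; X is a retract of a finite sum of copies of R, built one generator at a time. *)
Lemma dual_exact_projective K P M (i : phom K P) (p : phom P M) X :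
  dual_exact i p -> projective_module X ->
  forall f : phom K X, exists g : phom P X, g \oh i = f.
Proof.
move=> [_ _ hi] hX f.
pose inj F := forall f : phom K F, exists g : phom P F, g \oh i = f.
have cover n (e : 'I_n -> X) : exists F (u : phom F X), inj F /\
    forall c : 'I_n -> L^c, exists x, u x = \sum_(j < n) c j *: e j.
  elim: n e => [|n IH] e.
    (* For no generators, the zero map out of R already hits the empty sum. *)
    by exists R, 0; split=> // c; exists 0; rewrite big_ord0.
  have [F [u [hF us]]] := IH (fun j => e (widen_ord (leqnSn n) j)).
  have lin : linear (fun a : (L^c)^o => (a : L^c) *: e ord_max).
    by move=> a x y; rewrite scalerDl scalerA.
  pose v : phom R X := HB.pack_for {linear (L^c)^o -> X}
    (fun a : (L^c)^o => (a : L^c) *: e ord_max)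
    (GRing.isLinear.Build _ _ _ _ _ lin).
  exists (dsum F R), (u \oh dpr1 F R + v \oh dpr2 F R); split=> [h | c].
    have [g gE] := hF (dpr1 F R \oh h); have [g' gE'] := hi (dpr2 F R \oh h).
    exists (din1 F R \oh g + din2 F R \oh g'); have [_ _ _ _ b] := dsum_biproduct F R.
    by rewrite hcompDl -!hcompA gE gE' !hcompA -hcompDl b hcomp1f.
  have [x xE] := us (fun j => c (widen_ord (leqnSn n) j)).
  by exists (x, c ord_max); rewrite !hE big_ord_recr xE.
have [n [e He]] := modr_fg X; have [F [u [hF us]]] := cover n e.
have [s sE] : exists s : phom X F, u \oh s = hid X.
  by apply: hX => x; have [c ->] := He x; apply: us.
have [g gE] := hF (s \oh f).
by exists (u \oh g); rewrite -hcompA gE hcompA sE hcomp1f.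
Qed.

End Gorenstein.

(** * Regularity from semisimplicity *)

Section Regular.
Variable C : preadditive.
Implicit Types X Y Z : C.

Definition yoneda_map X Y (f : phom X Y) : nat_trans (yoneda X) (yoneda Y).
Proof.
exists (fun Z (z : phom Z X) => f \oh z) => [Z x y | Z T g x]; first exact: hcompBr.
exact: hcompA.
Defined.

Section Cokernel.
Variables (X Y : C) (f : phom X Y).

Definition coker_pred Z : phom Z Y -> bool := fun h => `[< exists z, f \oh z = h >].

Fact coker_pred_closed Z : zmod_closed (@coker_pred Z).
Proof.
split; first by apply/asboolP; exists 0; rewrite hcomp0r.
move=> _ _ /asboolP [x <-] /asboolP [y <-].
by apply/asboolP; exists (x - y); rewrite hcompBr.
Qed.

Definition coker_closed Z : zmodClosed (phom Z Y) :=
  HB.pack (@coker_pred Z) (GRing.isZmodClosed.Build (phom Z Y)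
    (@coker_pred Z) (@coker_pred_closed Z)).

Definition coker_obj Z : zmodType := Quotient.quot (coker_closed Z).

Definition coker_pi Z (h : phom Z Y) : coker_obj Z :=
  \pi_(Quotient.quot (coker_closed Z))%qT h.

Definition coker_rep Z (h : coker_obj Z) : phom Z Y :=
  @repr _ (Quotient.quot (coker_closed Z)) h.

Lemma coker_repK Z (h : coker_obj Z) : coker_pi (coker_rep h) = h.
Proof. exact: reprK. Qed.

Lemma coker_pi_eq Z (g h : phom Z Y) :
  coker_pi g = coker_pi h <-> exists z, f \oh z = g - h.
Proof.
have e := Quotient.idealrBE (coker_closed Z) g h.
split=> [/eqP gh | gh]; first by apply/asboolP; move: e; rewrite unfold_in => ->.
by apply/eqP; rewrite /coker_pi -e unfold_in; apply/asboolP.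
Qed.

Lemma coker_piB Z (g h : phom Z Y) : coker_pi (g - h) = coker_pi g - coker_pi h.
Proof. by rewrite /coker_pi raddfB. Qed.

Lemma coker_piD Z (g h : phom Z Y) : coker_pi (g + h) = coker_pi g + coker_pi h.
Proof. by rewrite /coker_pi raddfD. Qed.

Definition coker_map Z T (g : phom Z T) (h : coker_obj T) : coker_obj Z :=
  coker_pi (coker_rep h \oh g).

Lemma coker_mapE Z T (g : phom Z T) (h : phom T Y) :
  coker_map g (coker_pi h) = coker_pi (h \oh g).
Proof.
have /coker_pi_eq [z zE] := coker_repK (coker_pi h).
by apply/coker_pi_eq; exists (z \oh g); rewrite -hcompBl -zE hcompA.
Qed.

Definition coker_presheaf : presheaf C.
Proof.
refine (@Presheaf C coker_obj coker_map _ _ _ _).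
- move=> Z T g x y; rewrite -(coker_repK x) -(coker_repK y).
  by rewrite -coker_piB !coker_mapE -coker_piB hcompBl.
- by move=> Z x; rewrite -(coker_repK x) coker_mapE hcompf1.
- by move=> Z T U g h x; rewrite -(coker_repK x) !coker_mapE hcompA.
- by move=> Z T g h x; rewrite -(coker_repK x) !coker_mapE -coker_piD hcompDr.
Defined.

Definition coker_proj : nat_trans (yoneda Y) coker_presheaf.
Proof.
exists (fun Z (h : phom Z Y) => coker_pi h) => [Z g h | Z T g h].
  exact: coker_piB.
by rewrite /= coker_mapE.
Defined.

Lemma coker_presheaf_fp : finitely_presented coker_presheaf.
Proof.
exists X, Y, (yoneda_map f), coker_proj; split=> Z y.
  by exists (coker_rep y); apply: coker_repK.
have := coker_pi_eq y 0; rewrite subr0.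
by rewrite [coker_pi 0](raddf0 (\pi_(Quotient.quot (coker_closed Z))%qT)).
Qed.

End Cokernel.

Lemma yoneda_fp Y : finitely_presented (yoneda Y).
Proof.
exists Y, Y, (yoneda_map 0), (nt_id _); split=> Z y; first by exists y.
split=> [/= -> | [z <-]]; first by exists 0; exact: hcomp0l.
exact: hcomp0l.
Qed.

(** The projection of Hom(-, Y) onto the cokernel of Hom(-, f) has a section s. Its value e at the
    class of 1 satisfies e f = 0, as f has class 0, and 1 - e = f g, as e and 1 have the same class;
    hence f = (1 - e) f = f g f. *)
Lemma semisimple_regular : semisimple_abelian (fp_functors C) ->
  forall X Y (f : phom X Y), exists g : phom Y X, f \oh g \oh f = f.
Proof.
move=> [_ proj] X Y f.
pose F : fp_functors C := exist _ _ (coker_presheaf_fp f).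
pose H : fp_functors C := exist _ _ (yoneda_fp Y).
have [|s sE] := proj F H F (coker_proj f : mor H F) (idm F).
  move=> T g h e; apply: nat_trans_eq => Z x; rewrite -(coker_repK x).
  exact: (congr1 (fun u : nat_trans (yoneda Y) (sval T) => u Z (coker_rep x)) e).
pose e : phom Y Y := s Y (coker_pi f (hid Y)).
have es Z (h : phom Z Y) : s Z (coker_pi f h) = e \oh h.
  rewrite -[h in LHS]hcomp1f -coker_mapE; exact: (nt_nat s).
have ef : e \oh f = 0.
  rewrite -es; have -> : coker_pi f f = 0.
    have := (coker_pi_eq f f 0).2; rewrite subr0 => ->.
      exact: (raddf0 (\pi_(Quotient.quot (coker_closed f X))%qT)).
    by exists (hid X); rewrite hcompf1.
  by have := @ntB _ _ _ s X 0 0; rewrite !subrr.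
have /coker_pi_eq [g gE] : coker_pi f (hid Y) = coker_pi f e.
  pose G := coker_presheaf f.
  have := congr1 (fun u : nat_trans G G => u Y (coker_pi f (hid Y))) sE.
  by move=> /= sE'; rewrite -[LHS]sE'.
by exists g; rewrite gE hcompBl ef hcomp1f subr0.
Qed.

End Regular.

Lemma quotient_regular (C : preadditive) (I : cat_ideal C) :
  semisimple_abelian (fp_functors (quot_cat I)) ->
  forall (X Y : C) (f : phom X Y), exists g : phom Y X,
    ideal_mem I (f \oh g \oh f - f).
Proof.
move=> ss X Y f.
have [g gE] := semisimple_regular ss (qpi I f : @phom (quot_cat I) X Y).
exists (qrep g); apply: (qpi_eq I (f \oh qrep g \oh f) f).1.
by rewrite -[RHS]gE -[in RHS](qrepK g) -!qcompE.
Qed.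

Lemma stable_regular (L : nzRingType) :
  semisimple_abelian (fp_functors (stable_Gprj_cat L)) ->
  forall (X Y : mod_cat L) (f : phom X Y), Gprj X -> Gprj Y ->
  exists g : phom Y X, factors_projective (f \oh g \oh f - f).
Proof.
move=> ss X Y f GX GY.
exact (@quotient_regular (Gprj_cat L) (projective_ideal L) ss
  (exist _ X GX) (exist _ Y GY) f).
Qed.

(** * The morphism category and exactness of the sequence *)

Section MorphismCategory.
Variable C : preadditive.

Section Components.
Variables X Y : mor_cat C.
Implicit Types u v : phom X Y.

Definition top u : phom (mdom X) (mdom Y) := (u : mor_hom X Y).1.
Definition bot u : phom (mcod X) (mcod Y) := (u : mor_hom X Y).2.

Lemma square u : bot u \oh marr X = marr Y \oh top u.
Proof. exact: mor_homP. Qed.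

Lemma mor_ext u v : top u = top v -> bot u = bot v -> u = v.
Proof. exact: mor_hom_eq. Qed.

Lemma topD u v : top (u + v) = top u + top v. Proof. by []. Qed.
Lemma botD u v : bot (u + v) = bot u + bot v. Proof. by []. Qed.
Lemma top0 : top 0 = 0. Proof. by []. Qed.
Lemma bot0 : bot 0 = 0. Proof. by []. Qed.

End Components.

Lemma topM X Y Z (v : @phom (mor_cat C) Y Z) (u : @phom (mor_cat C) X Y) :
  top (v \oh u) = top v \oh top u.
Proof. by []. Qed.
Lemma botM X Y Z (v : @phom (mor_cat C) Y Z) (u : @phom (mor_cat C) X Y) :
  bot (v \oh u) = bot v \oh bot u.
Proof. by []. Qed.
Lemma top1 X : top (@hid (mor_cat C) X) = hid (mdom X). Proof. by []. Qed.
Lemma bot1 X : bot (@hid (mor_cat C) X) = hid (mcod X). Proof. by []. Qed.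

Definition square_mor (X Y : mor_cat C) a b (h : b \oh marr X = marr Y \oh a) :
  @phom (mor_cat C) X Y := mkmor h.

Definition morE := (topD, botD, top0, bot0, topM, botM, top1, bot1).

Lemma mor_iso (X Y : mor_cat C) (u : phom X Y) :
  @isomorphism C _ _ (top u) -> @isomorphism C _ _ (bot u) ->
  @isomorphism (mor_cat C) X Y u.
Proof.
case=> a [/= a1 a2] [b [/= b1 b2]].
have e : b \oh marr Y = marr X \oh a.
  by rewrite -[marr Y]hcompf1 -a2 (hcompA (marr Y)) -square !hcompA b1 hcomp1f.
by exists (square_mor e); split; apply: mor_ext; rewrite /= ?morE.
Qed.

Lemma mor_zero_object (Z : C) : zero_object Z ->
  @zero_object (mor_cat C) (Hobj (hid Z)).
Proof. by move=> /zero_objectP Z0; apply/zero_objectP/mor_ext. Qed.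

Section Exactness.
Hypothesis C0 : exists Z : C, zero_object Z.
Variables (Q O P : C) (p1 : phom Q O) (i0 : phom O P).
Variables (Y : mor_cat C).
Variables (j1 : phom (Hobj (i0 \oh p1)) Y) (j2 : phom (Hobj (hid O)) Y).
Variables (q1 : phom Y (Hobj (i0 \oh p1))) (q2 : phom Y (Hobj (hid O))).
Hypothesis b : is_biproduct j1 j2 q1 q2.

Let col : phom (Hobj p1) Y := j1 \oh phi1 p1 i0 + j2 \oh phi2 p1.
Let row : phom Y (Hobj i0) := psi1 p1 i0 \oh q1 + psi2 i0 \oh q2.

Lemma pr1_col : q1 \oh col = phi1 p1 i0.
Proof.
by case: b => e1 e2 e3 e4 _; rewrite hcompDr !hcompA e1 e3 hcomp1f hcomp0l addr0.
Qed.
Lemma pr2_col : q2 \oh col = phi2 p1.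
Proof.
by case: b => e1 e2 e3 e4 _; rewrite hcompDr !hcompA e2 e4 hcomp1f hcomp0l add0r.
Qed.
Lemma row_in1 : row \oh j1 = psi1 p1 i0.
Proof.
by case: b => e1 e2 e3 e4 _; rewrite hcompDl -!hcompA e1 e4 hcompf1 hcomp0r addr0.
Qed.
Lemma row_in2 : row \oh j2 = psi2 i0.
Proof.
by case: b => e1 e2 e3 e4 _; rewrite hcompDl -!hcompA e2 e3 hcompf1 hcomp0r add0r.
Qed.

Lemma row_comp T (u : phom T Y) :
  row \oh u = psi1 p1 i0 \oh (q1 \oh u) + psi2 i0 \oh (q2 \oh u).
Proof. by rewrite hcompDl !hcompA. Qed.

Lemma comp_col T (u : phom Y T) :
  u \oh col = u \oh j1 \oh phi1 p1 i0 + u \oh j2 \oh phi2 p1.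
Proof. by rewrite hcompDr !hcompA. Qed.

Lemma top_row T (u : phom T Y) :
  top (row \oh u) = p1 \oh top (q1 \oh u) - top (q2 \oh u).
Proof. by rewrite row_comp topD !(topM (psi1 _ _), topM (psi2 _)) hcompNl hcomp1f. Qed.

Lemma bot_row T (u : phom T Y) :
  bot (row \oh u) = bot (q1 \oh u) - i0 \oh bot (q2 \oh u).
Proof. by rewrite row_comp botD !(botM (psi1 _ _), botM (psi2 _)) hcompNl hcomp1f. Qed.

Lemma top_col T (u : phom Y T) :
  top (u \oh col) = top (u \oh j1) + top (u \oh j2) \oh p1.
Proof. by rewrite comp_col topD !(topM _ (phi1 _ _), topM _ (phi2 _)) hcompf1. Qed.

Lemma bot_col T (u : phom Y T) :
  bot (u \oh col) = bot (u \oh j1) \oh i0 + bot (u \oh j2).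
Proof. by rewrite comp_col botD !(botM _ (phi1 _ _), botM _ (phi2 _)) hcompf1. Qed.

(** Both levels are split exact, Q -> Q + O -> O and O -> P + O -> P, so the universal
    factorisations can be read off: into the kernel from the Q-coordinate above and the O-coordinate
    below, out of the cokernel from minus the O-coordinate above and the P-coordinate below. *)
Lemma short_exact_sequence : @short_exact (mor_cat C) _ _ _ col row.
Proof.
have [Z0 /mor_zero_object HZ] := C0; have zP := zero_morphismP HZ.
have rc : row \oh col = 0.
  apply: mor_ext; first by rewrite top_row pr1_col pr2_col hcompf1 subrr.
  by rewrite bot_row pr1_col pr2_col hcompf1 subrr.
case: (b) => e1 e2 e3 e4 e; split; split; try exact/zP.
- move=> T h /zP h0; have := top_row h; rewrite h0 top0 => /esym/eqP.
  rewrite subr_eq0 => /eqP th; have := bot_row h; rewrite h0 bot0 => /esym/eqP.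
  rewrite subr_eq0 => /eqP bh.
  have sq : bot (q2 \oh h) \oh marr T = marr (Hobj p1) \oh top (q1 \oh h).
    by rewrite square hcomp1f -th.
  pose u0 : phom T (Hobj p1) := @square_mor T (Hobj p1) _ _ sq.
  exists u0; split=> [|u uE].
    change (col \oh u0 = h); rewrite /col -[RHS]hcomp1f -e !hcompDl -!hcompA.
    have -> : phi1 p1 i0 \oh u0 = q1 \oh h.
      by apply: mor_ext; rewrite (topM, botM) ?bh // [LHS]hcomp1f.
    suff -> : phi2 p1 \oh u0 = q2 \oh h by [].
    by apply: mor_ext; rewrite (topM, botM) ?[LHS]hcomp1f.
  have u1 : q1 \oh h = phi1 p1 i0 \oh u by rewrite -uE hcompA pr1_col.
  have u2 : q2 \oh h = phi2 p1 \oh u by rewrite -uE hcompA pr2_col.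
  apply: mor_ext; first by rewrite [LHS]/(top (q1 \oh h)) u1; exact: hcomp1f.
  by rewrite [LHS]/(bot (q2 \oh h)) u2; exact: hcomp1f.
- move=> T h /zP h0; have := top_col h; rewrite h0 top0 => /esym/eqP.
  rewrite addrC addr_eq0 => /eqP th; have := bot_col h; rewrite h0 bot0 => /esym/eqP.
  rewrite addr_eq0 => /eqP bh.
  have sq : bot (h \oh j1) \oh marr (Hobj i0) = marr T \oh (- top (h \oh j2)).
    by rewrite bh hcompNr -square hcompf1.
  pose u0 : phom (Hobj i0) T := @square_mor (Hobj i0) T _ _ sq.
  exists u0; split=> [|u uE].
    change (u0 \oh row = h); rewrite /row -[RHS]hcompf1 -e !hcompDr !hcompA.
    have -> : u0 \oh psi1 p1 i0 = h \oh j1.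
      apply: mor_ext; rewrite (topM, botM) ?[LHS]hcompf1 //.
      by rewrite [top u0]/(- _) hcompNl th opprK.
    suff -> : u0 \oh psi2 i0 = h \oh j2 by [].
    apply: mor_ext; rewrite (topM, botM).
      by rewrite [top u0]/(- _) hcompNl hcompNr opprK hcompf1.
    by rewrite hcompNr bh opprK.
  have u1 : h \oh j1 = u \oh psi1 p1 i0 by rewrite -uE -hcompA row_in1.
  have u2 : h \oh j2 = u \oh psi2 i0 by rewrite -uE -hcompA row_in2.
  apply: mor_ext; last by rewrite [LHS]/(bot (h \oh j1)) u1; exact: hcompf1.
  have e2u : top (u \oh psi2 i0) = - top u by rewrite topM hcompNr hcompf1.
  have u0E : top u0 = - top (h \oh j2) by [].
  by rewrite u0E u2 e2u opprK.
Qed.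

End Exactness.
End MorphismCategory.

(** * The almost split sequence *)

Lemma H_zero_morphism (L : nzRingType) (X Y : H_cat L) (f : phom X Y) :
  f = 0 -> @zero_morphism (H_cat L) _ _ f.
Proof.
have [Z /mor_zero_object Z0] := module_zero_object L.
by move/(zero_morphismP Z0).
Qed.

(** * Maps factoring through projectives *)

Section Stable.
Variable L : nzRingType.
Implicit Types X Y : mod_cat L.

Lemma factors_projectiveN X Y (f : phom X Y) :
  factors_projective f -> factors_projective (- f).
Proof.
move=> hf; rewrite -sub0r.
exact: factors_projectiveB (factors_projective0 _ _) hf.
Qed.

Lemma factors_projectiveD X Y (f g : phom X Y) :
  factors_projective f -> factors_projective g -> factors_projective (f + g).
Proof.
by move=> hf /factors_projectiveN hg; rewrite -[g]opprK; apply: factors_projectiveB.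
Qed.

Lemma projective_factors P X Y (a : phom X P) (b : phom P Y) :
  projective_module P -> factors_projective (b \oh a).
Proof. by move=> hP; exists P; split=> //; exists a, b. Qed.

Lemma factors_lift P X Y (p : phom P Y) (f : phom X Y) :
  surj p -> factors_projective f -> exists g : phom X P, p \oh g = f.
Proof.
move=> ps [R [hR [a [b ->]]]]; have [c cE] := hR _ _ p b ps.
by exists (c \oh a); rewrite hcompA cE.
Qed.

Lemma factors_extend K P M X (i : phom K P) (p : phom P M) (f : phom K X) :
  dual_exact i p -> factors_projective f -> exists g : phom P X, g \oh i = f.
Proof.
move=> ip [R [hR [a [b ->]]]]; have [c cE] := dual_exact_projective ip hR a.
by exists (b \oh c); rewrite -hcompA cE.
Qed.

End Stable.

(** * Stable endomorphisms of the syzygy *)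

Section AlmostSplit.
Variables (k : comNzRingType) (L : algType k).
Hypotheses (hL : artin_algebra L)
  (hss : semisimple_abelian (fp_functors (stable_Gprj_cat L))).
Variables (A Q O P : mod_cat L) (p1 : phom Q O) (i0 : phom O P) (p0 : phom P A).
Hypotheses (hGA : Gprj A) (hA : @indecomposable (mod_cat L) A)
  (hnA : ~ projective_module A) (hcov1 : projective_cover p1)
  (hex0 : exact_sequence i0 p0) (hcov0 : projective_cover p0).
Implicit Types X Y T U V : mod_cat L.

Let hP : projective_module P. Proof. by case: hcov0. Qed.
Let hQ : projective_module Q. Proof. by case: hcov1. Qed.
Let p1s : surj p1. Proof. by case: hcov1. Qed.
Let p0s : surj p0. Proof. by case: hcov0. Qed.
Let i0i : injective i0. Proof. exact: exact_inj hex0. Qed.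
Let d0 : dual_exact i0 p0. Proof. exact: exact_dual. Qed.
Let GO : Gprj O. Proof. exact: Gprj_cover_kernel hex0 hcov0. Qed.

Lemma cover_endo_iso X Y (p : phom X Y) (x : phom X X) :
  projective_cover p -> surj (p \oh x) -> @isomorphism (mod_cat L) X X x.
Proof. by move=> [_ _ ess] /ess; apply: surj_endo_iso. Qed.

Lemma projective_of_section (v : phom A P) : p0 \oh v = hid A -> False.
Proof. by move=> pv; apply: hnA; apply: retract_projective hP pv. Qed.

(** Otherwise the identity of O extends along i0, so the sequence over A splits and A is
    projective. *)
Lemma syzygy_not_stably_zero : ~ factors_projective (hid O).
Proof.
move=> /(factors_extend d0) [w wi].
have [|v vE] := factor_cokernel (f := hid P - i0 \oh w) hex0.
  by rewrite hcompBl -hcompA wi hcompf1 hcomp1f subrr.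
apply: (@projective_of_section v); apply: (surj_epi p0s).
by rewrite -hcompA vE hcompBr hcompA (exact_comp0 hex0) hcomp0l subr0 hcompf1 hcomp1f.
Qed.

(** Endomorphisms of A through p0 are never invertible, as A is not a summand of P; locality does
    the rest. *)
Lemma iso_one_plus_p0 (v : phom A P) : @isomorphism (mod_cat L) A A (hid A + p0 \oh v).
Proof.
have [|] := indecomposable_local (- (p0 \oh v)) hL hA; last by rewrite opprK.
case/iso_inv=> g [_ vg].
by case: (@projective_of_section (- (v \oh g))); rewrite hcompNr hcompA -hcompNl.
Qed.

Lemma syzygy_endo_iso (x : phom O O) :
  factors_projective (x - hid O) -> @isomorphism (mod_cat L) O O x.
Proof.
move=> /(factors_extend d0) [w wi].
have xE : x = hid O + w \oh i0 by rewrite wi addrC subrK.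
have px : p0 \oh (hid P + i0 \oh w) = p0.
  by rewrite hcompDr hcompA (exact_comp0 hex0) hcomp0l addr0 hcompf1.
have [|y [yx _]] := iso_inv (@cover_endo_iso _ _ p0 (hid P + i0 \oh w) hcov0 _).
  by rewrite px.
apply: inj_endo_iso => //; apply: hom_inj => z xz; apply: (exact_inj0 hex0).
have <- : (y \oh (i0 \oh x)) z = i0 z.
  rewrite xE hcompDr hcompf1 hcompA -[i0 in i0 + _]hcomp1f -hcompDl hcompA yx.
  by rewrite hcomp1f.
by rewrite !hcE xz !hom0.
Qed.

Lemma deflation_endo_iso (x : @phom (H_cat L) (Hobj p1) (Hobj p1)) :
  factors_projective (bot x - hid O) -> @isomorphism (H_cat L) _ _ x.
Proof.
move=> /syzygy_endo_iso xi; apply: mor_iso => //.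
have sq : bot x \oh p1 = p1 \oh top x := square x.
apply: (cover_endo_iso hcov1); rewrite [p1 \oh _](esym sq).
by apply: surj_comp => //; apply: iso_surj.
Qed.

(** Modulo a map into O, the lower component is 1 + v p0, so it induces 1 + p0 v on A, which is
    invertible; the cover p0 lifts this to P. *)
Lemma inflation_endo_iso (x : @phom (H_cat L) (Hobj i0) (Hobj i0)) :
  factors_projective (top x - hid O) -> @isomorphism (H_cat L) _ _ x.
Proof.
move=> hx; apply: mor_iso; first exact: syzygy_endo_iso.
have [w wE] := factors_extend d0 hx.
have sq : bot x \oh i0 = i0 \oh top x := square x.
have [|v vE] := factor_cokernel (f := bot x - hid P - i0 \oh w) hex0.
  rewrite !hcompBl sq -hcompA wE hcompBr hcompf1 hcomp1f.
  by rewrite opprB addrA subrK subrr.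
apply: (cover_endo_iso hcov0).
have -> : p0 \oh bot x = (hid A + p0 \oh v) \oh p0.
  rewrite hcompDl hcomp1f -hcompA vE !hcompBr hcompf1 !hcompA (exact_comp0 hex0).
  by rewrite hcomp0l subr0 addrC subrK.
by apply: surj_comp => //; apply/iso_surj/iso_one_plus_p0.
Qed.

(** The induced t is stably idempotent and invertible, hence stably 1, and this transfers back to e.
    Concretely f f - f = i0 w + v p0, and the inverse s of t gives s p0 v p0 = p0 f - p0. With s'
    lifting s to P, the map 1 - f + s' v p0 lands in O and restricts to 1 - e on O. *)
Lemma syzygy_idempotent_iso (e : phom O O) (f : phom P P) (t : phom A A) :
  f \oh i0 = i0 \oh e -> t \oh p0 = p0 \oh f ->
  factors_projective (e \oh e - e) -> @isomorphism (mod_cat L) A A t ->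
  factors_projective (hid O - e).
Proof.
move=> fe tf /(factors_extend d0) [w wE] /iso_inv [s [st _]].
have [|v vE] := factor_cokernel (f := f \oh f - f - i0 \oh w) hex0.
  rewrite !hcompBl -!hcompA wE fe hcompBr !hcompA fe.
  by rewrite opprB addrA subrK subrr.
have spf : s \oh p0 \oh f = p0 by rewrite -hcompA -tf hcompA st hcomp1f.
have spv : s \oh p0 \oh v \oh p0 = p0 \oh f - p0.
  rewrite -hcompA vE !hcompBr (hcompA _ f f) spf (hcompA _ i0 w) -(hcompA s).
  by rewrite (exact_comp0 hex0) hcomp0r hcomp0l subr0.
have [s' s'E] := hP (s \oh p0) p0s.
have [|w' w'E] := lift_kernel (f := hid P - f + s' \oh v \oh p0) hex0.
  rewrite hcompDr !hcompA s'E spv hcompBr hcompf1.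
  by rewrite addrA subrK subrr.
have -> : hid O - e = w' \oh i0.
  apply: (inj_mono i0i); rewrite hcompA w'E hcompDl -(hcompA _ p0 i0).
  by rewrite (exact_comp0 hex0) hcomp0r addr0 hcompBl hcompBr hcompf1 hcomp1f fe.
exact: projective_factors.
Qed.

Lemma syzygy_stable_idempotent (e : phom O O) :
  factors_projective (e \oh e - e) ->
  factors_projective e \/ factors_projective (hid O - e).
Proof.
move=> he; have [f fe] := dual_exact_projective d0 hP (i0 \oh e).
have [|t tf] := factor_cokernel (f := p0 \oh f) hex0.
  by rewrite -hcompA fe hcompA (exact_comp0 hex0) hcomp0l.
have [ti | ti] := indecomposable_local t hL hA.
  by right; apply: (syzygy_idempotent_iso fe tf).
left; have -> : e = hid O - (hid O - e) by rewrite opprB addrC subrK.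
apply: (@syzygy_idempotent_iso _ (hid P - f) (hid A - t)) => //.
- by rewrite hcompBl hcompBr fe hcomp1f hcompf1.
- by rewrite hcompBl hcompBr tf hcomp1f hcompf1.
rewrite hcompBl !hcompBr !hcomp1f hcompf1.
by rewrite addrAC subrr sub0r opprB.
Qed.

(** * The dichotomy for stable factorisations *)

(** With t s t = t stably, e = 1 - s t projects onto the stable kernel of t. If a e vanishes stably,
    a factors as (a s) t; otherwise, for a regular inverse g of a e, the stable idempotent a e g is
    nonzero, hence 1. *)
Lemma stable_factor_right U V (t : phom U V) (a : phom U O) :
  Gprj U -> Gprj V ->
  (exists c : phom V O, factors_projective (a + c \oh t)) \/
  (exists g : phom O U, factors_projective (a \oh g - hid O) /\
     factors_projective (t \oh g)).
Proof.
move=> GU GV; have [s ts] := stable_regular hss t GU GV.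
have [e eE] : exists e, e = hid U - s \oh t by exists (hid U - s \oh t).
have te : factors_projective (t \oh e).
  by rewrite eE hcompBr hcompf1 hcompA -opprB; apply: factors_projectiveN.
have [ae | nae] := pselect (factors_projective (a \oh e)).
  left; exists (- (a \oh s)); rewrite hcompNl.
  by move: ae; rewrite eE hcompBr hcompf1 hcompA.
have [g gE] := stable_regular hss (a \oh e) GU GO; right; exists (e \oh g).
split; last by rewrite hcompA; apply: factors_projectiveMr.
have [|hz|h1] := @syzygy_stable_idempotent (a \oh e \oh g).
- move: (factors_projectiveMr g gE); rewrite hcompBl.
  by rewrite -(hcompA _ (a \oh e) g).
- case: nae.
  have -> : a \oh e = a \oh e \oh g \oh (a \oh e) -
      (a \oh e \oh g \oh (a \oh e) - a \oh e) by rewrite opprB addrC subrK.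
  by apply: factors_projectiveB => //; apply: factors_projectiveMr.
by rewrite hcompA -opprB; apply: factors_projectiveN.
Qed.

Lemma stable_factor_left U V (t : phom U V) (b : phom O V) :
  Gprj U -> Gprj V ->
  (exists c : phom O U, factors_projective (b - t \oh c)) \/
  (exists g : phom V O, factors_projective (g \oh b - hid O) /\
     factors_projective (g \oh t)).
Proof.
move=> GU GV; have [s ts] := stable_regular hss t GU GV.
have [e eE] : exists e, e = hid V - t \oh s by exists (hid V - t \oh s).
have et : factors_projective (e \oh t).
  by rewrite eE hcompBl hcomp1f -opprB; apply: factors_projectiveN.
have [eb | neb] := pselect (factors_projective (e \oh b)).
  left; exists (s \oh b).
  by move: eb; rewrite eE hcompBl hcomp1f hcompA.
have [g gE] := stable_regular hss (e \oh b) GO GV; right; exists (g \oh e).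
split; last by rewrite -hcompA; apply: factors_projectiveMl.
have [|hz|h1] := @syzygy_stable_idempotent (g \oh (e \oh b)).
- move: (factors_projectiveMl g gE); rewrite hcompBr.
  by rewrite !hcompA.
- case: neb.
  have -> : e \oh b = e \oh b \oh (g \oh (e \oh b)) -
      (e \oh b \oh g \oh (e \oh b) - e \oh b) by rewrite hcompA opprB addrC subrK.
  by apply: factors_projectiveB => //; apply: factors_projectiveMl.
by rewrite -hcompA -opprB; apply: factors_projectiveN.
Qed.

(** * Almost splitness and minimality *)

Let W : H_cat L := Hobj (i0 \oh p1).
Let I : H_cat L := Hobj (hid O).
Let col := hcol (phi1 p1 i0) (phi2 p1).
Let row := hrow (psi1 p1 i0) (psi2 i0).
Let b := hsum_biproduct W I.

(** The component through W passes through Q above; the component through the identity of O, being a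
    commutative square out of i0, passes through P. *)
Lemma row_stably_zero (w : phom (Hobj i0 : H_cat L) (hsum W I)) :
  factors_projective (top (row \oh w)).
Proof.
rewrite (top_row (hpr1 W I) (hpr2 W I)).
have <- : bot (hpr2 W I \oh w) \oh i0 = top (hpr2 W I \oh w).
  by rewrite -[RHS]hcomp1f; exact: (square (hpr2 W I \oh w)).
by apply: factors_projectiveB; apply: projective_factors.
Qed.

Lemma col_stably_zero (w : phom (hsum W I) (Hobj p1 : H_cat L)) :
  factors_projective (bot (w \oh col)).
Proof.
rewrite (bot_col (hin1 W I) (hin2 W I)).
have -> : bot (w \oh hin2 W I) = p1 \oh top (w \oh hin2 W I).
  by rewrite -[LHS]hcompf1; exact: (square (w \oh hin2 W I)).
by apply: factors_projectiveD; apply: projective_factors.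
Qed.

Lemma row_not_split_epi : ~ @split_epi (H_cat L) _ _ row.
Proof.
case=> u rowu; apply: syzygy_not_stably_zero.
by have := row_stably_zero u; rewrite [row \oh u]rowu.
Qed.

Lemma col_not_split_mono : ~ @split_mono (H_cat L) _ _ col.
Proof.
case=> u ucol; apply: syzygy_not_stably_zero.
by have := col_stably_zero u; rewrite [u \oh col]ucol.
Qed.

Lemma row_right_almost_split :
  @right_almost_split (H_cat L) (mor_in (@Gprj L)) _ _ row.
Proof.
split=> [|T h [GU GV] hns]; first exact: row_not_split_epi.
have sq : bot h \oh marr T = i0 \oh top h := square h.
have [[c cE] | [g [hg tg]]] := stable_factor_right (marr T) (top h) GU GV.
  have [a aE] := factors_lift p1s cE.
  (* The lift has components (a, bot h + i0 c) into W and (c t, c) into the identity of O, where t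
     is the arrow of T; the row subtracts the c-terms again. *)
  have sq1 : (bot h + i0 \oh c) \oh marr T = marr W \oh a.
    by rewrite hcompDl sq -!hcompA aE hcompDr.
  have sq2 : c \oh marr T = marr I \oh (c \oh marr T) by rewrite hcomp1f.
  pose u1 : phom T W := @square_mor _ T W _ _ sq1.
  pose u2 : phom T I := @square_mor _ T I _ _ sq2.
  exists (hin1 W I \oh u1 + hin2 W I \oh u2).
  have [e1 e2 e3 e4 _] := b.
  change (row \oh (hin1 W I \oh u1 + hin2 W I \oh u2) = h).
  have q1 : hpr1 W I \oh (hin1 W I \oh u1 + hin2 W I \oh u2) = u1.
    by rewrite hcompDr !hcompA e1 e3 hcomp1f hcomp0l addr0.
  have q2 : hpr2 W I \oh (hin1 W I \oh u1 + hin2 W I \oh u2) = u2.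
    by rewrite hcompDr !hcompA e2 e4 hcomp1f hcomp0l add0r.
  have [tr br] := (top_row (hpr1 W I) (hpr2 W I), bot_row (hpr1 W I) (hpr2 W I)).
  apply: mor_ext; rewrite ?tr ?br q1 q2.
    by change (p1 \oh a - c \oh marr T = top h); rewrite aE addrK.
  by change (bot h + i0 \oh c - i0 \oh c = bot h); rewrite addrK.
(* Here g is a stable section of the top of h; since t g is stably zero it extends over P, giving
   the morphism z = (g, d) from i0 to T. *)
case: hns; have [d dE] := factors_extend d0 tg.
pose z : phom (Hobj i0 : H_cat L) T := @square_mor _ (Hobj i0) T _ _ dE.
have /iso_inv [y [_ zy]] : @isomorphism (H_cat L) _ _ (h \oh z).
  exact: inflation_endo_iso.
by exists (z \oh y); rewrite -[RHS]zy; exact: hcompA.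
Qed.

Lemma col_left_almost_split :
  @left_almost_split (H_cat L) (mor_in (@Gprj L)) _ _ col.
Proof.
split=> [|T h [GU GV] hns]; first exact: col_not_split_mono.
have sq : bot h \oh p1 = marr T \oh top h := square h.
have [[c cE] | [g [hg gt]]] := stable_factor_left (marr T) (bot h) GU GV.
  have [d dE] := factors_extend d0 cE.
  (* Dual formulas: (top h - c p1, d) out of W and (c, t c) out of the identity of O, where d
     extends bot h - t c along i0. *)
  have sq1 : d \oh marr W = marr T \oh (top h - c \oh p1).
    by rewrite [marr W]/(i0 \oh p1) hcompA dE hcompBl hcompBr sq hcompA.
  have sq2 : marr T \oh c \oh marr I = marr T \oh c by rewrite hcompf1.
  pose u1 : phom W T := @square_mor _ W T _ _ sq1.
  pose u2 : phom I T := @square_mor _ I T _ _ sq2.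
  exists (u1 \oh hpr1 W I + u2 \oh hpr2 W I).
  have [e1 e2 e3 e4 _] := b.
  change ((u1 \oh hpr1 W I + u2 \oh hpr2 W I) \oh col = h).
  have q1 : (u1 \oh hpr1 W I + u2 \oh hpr2 W I) \oh hin1 W I = u1.
    by rewrite hcompDl -!hcompA e1 e4 hcompf1 hcomp0r addr0.
  have q2 : (u1 \oh hpr1 W I + u2 \oh hpr2 W I) \oh hin2 W I = u2.
    by rewrite hcompDl -!hcompA e2 e3 hcompf1 hcomp0r add0r.
  have [tc bc] := (top_col (hin1 W I) (hin2 W I), bot_col (hin1 W I) (hin2 W I)).
  apply: mor_ext; rewrite ?tc ?bc q1 q2.
    by change (top h - c \oh p1 + c \oh p1 = top h); rewrite subrK.
  by change (d \oh i0 + marr T \oh c = bot h); rewrite dE subrK.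
case: hns; have [d dE] := factors_lift p1s gt.
pose z : phom T (Hobj p1 : H_cat L) := @square_mor _ T (Hobj p1) _ _ (esym dE).
have /iso_inv [y [yz _]] : @isomorphism (H_cat L) _ _ (z \oh h).
  exact: deflation_endo_iso.
by exists (y \oh z); rewrite -[RHS]yz; exact: esym (hcompA _ _ _).
Qed.

Lemma col_row_exact : @short_exact (H_cat L) _ _ _ col row.
Proof. exact (short_exact_sequence (module_zero_object L) b). Qed.

Lemma col_left_minimal : @left_minimal (H_cat L) _ _ col.
Proof.
move=> h hcol; have [_ [_ coker]] := col_row_exact.
have [|w [wE _]] := coker _ (h - hid (hsum W I)).
  apply: H_zero_morphism; change ((h - hid (hsum W I)) \oh col = 0).
  by rewrite hcompBl hcomp1f [h \oh col]hcol subrr.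
have -> : h = hid (hsum W I) + w \oh row by rewrite [w \oh row]wE addrC subrK.
apply: iso_1Dba; apply: inflation_endo_iso.
by rewrite topD addrC addKr; apply: row_stably_zero.
Qed.

Lemma row_right_minimal : @right_minimal (H_cat L) _ _ row.
Proof.
move=> h rowh; have [[_ ker] _] := col_row_exact.
have [|w [wE _]] := ker _ (h - hid (hsum W I)).
  apply: H_zero_morphism; change (row \oh (h - hid (hsum W I)) = 0).
  by rewrite hcompBr hcompf1 [row \oh h]rowh subrr.
have -> : h = hid (hsum W I) + col \oh w by rewrite [col \oh w]wE addrC subrK.
apply: iso_1Dba; apply: deflation_endo_iso.
by rewrite botD addrC addKr; apply: col_stably_zero.
Qed.

Lemma syzygy_almost_split_sequence :
  @almost_split_sequence (H_cat L) (mor_in (@Gprj L)) _ _ _ col row.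
Proof.
have GP : Gprj P by apply: projective_Gprj.
have GQ : Gprj Q by apply: projective_Gprj.
split; try by [split | split; apply: Gprj_dsum].
- exact: col_row_exact.
- exact: col_left_almost_split.
- exact: col_left_minimal.
- exact: row_right_almost_split.
- exact: row_right_minimal.
Qed.

(** * Indecomposability of the middle summand *)

(** The idempotent 1 - [bot f] does not change p0, so it is surjective because p0 is essential,
    hence the identity. The square then gives p1 [top f] = 0, and the same argument applies to
    p1. *)
Lemma middle_idempotent0 (f : @phom (H_cat L) W W) :
  f \oh f = f -> p0 \oh bot f = 0 -> f = 0.
Proof.
move=> ff pf0; have sq : bot f \oh (i0 \oh p1) = i0 \oh p1 \oh top f := square f.
have f2 : bot f = 0.
  apply/eqP; rewrite -oppr_eq0 -[X in X == _](addKr (hid P)) addrC subr_eq0.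
  apply/eqP; apply: idempotent_surj.
    rewrite hcompBl !hcompBr !hcomp1f hcompf1 -botM ff.
    by rewrite subrr subr0.
  by case: hcov0 => _ _; apply; rewrite hcompBr hcompf1 pf0 subr0.
have pf : p1 \oh top f = 0.
  by apply: (inj_mono i0i); rewrite hcompA -sq f2 hcomp0l hcomp0r.
apply: mor_ext => //.
apply/eqP; rewrite -oppr_eq0 -[X in X == _](addKr (hid Q)) addrC subr_eq0.
apply/eqP; apply: idempotent_surj.
  rewrite hcompBl !hcompBr !hcomp1f hcompf1 -topM ff.
  by rewrite subrr subr0.
by case: hcov1 => _ _; apply; rewrite hcompBr hcompf1 pf subr0.
Qed.

Lemma middle_indecomposable : @indecomposable (H_cat L) W.
Proof.
split=> [/zero_objectP W0 | X1 X2 j1 j2 q1 q2 [e1 e2 e3 e4 e]].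
  case: hA => nA _; apply: nA; apply/zero_objectP.
  apply: (surj_epi p0s); rewrite hcomp1f hcomp0l -[p0]hcompf1.
  by rewrite -(bot1 W) W0 bot0 hcomp0r.
have idem (f : @phom (H_cat L) W W) : f \oh f = f ->
    p0 \oh bot f = 0 \/ p0 \oh bot f = p0.
  move=> ff; have sq : bot f \oh (i0 \oh p1) = i0 \oh p1 \oh top f := square f.
  (* As p1 is surjective, the image of i0 p1 is all of O, so [bot f] preserves O and induces an
     idempotent of A. *)
  have [|t tf] := factor_cokernel (f := p0 \oh bot f) hex0.
    apply: (surj_epi p1s); rewrite -!hcompA sq !hcompA.
    by rewrite (exact_comp0 hex0) !hcomp0l.
  have bb : bot f \oh bot f = bot f by rewrite -botM ff.
  have tt : t \oh t = t.
    by apply: (surj_epi p0s); rewrite -hcompA tf hcompA tf -hcompA bb.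
  by have [t0 | t1] := indecomposable_idempotent hA tt; [left | right];
    rewrite -tf ?t0 ?t1 ?hcomp0l ?hcomp1f.
have summand0 (X : H_cat L) (j : phom X W) (q : phom W X) :
    q \oh j = hid X -> j \oh q = 0 -> zero_object X.
  move=> qj jq; apply/zero_objectP.
  by rewrite -[LHS]hcompf1 -{1}qj -qj -hcompA (hcompA j) jq hcomp0l hcomp0r.
have jj1 : (j1 \oh q1) \oh (j1 \oh q1) = j1 \oh q1.
  by rewrite -hcompA (hcompA q1) e1 hcomp1f.
have jj2 : (j2 \oh q2) \oh (j2 \oh q2) = j2 \oh q2.
  by rewrite -hcompA (hcompA q2) e2 hcomp1f.
have [h | h] := idem _ jj1; [left | right].
  by apply: summand0 e1 _; apply: middle_idempotent0.
apply: summand0 e2 _; apply: middle_idempotent0 => //.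
have -> : j2 \oh q2 = hid W - j1 \oh q1 by rewrite -e addrC addKr.
have -> : bot (hid W - j1 \oh q1) = hid P - bot (j1 \oh q1) by [].
by rewrite hcompBr h hcompf1 subrr.
Qed.

End AlmostSplit.

Theorem proposition4p3 (k : comNzRingType) (L : algType k)
  (hL : OmegaG_algebra L)
  (A : mod_cat L) (hGA : Gprj A) (hA : indecomposable A)
  (hnA : ~ projective_module A)
  (Om2 Q Om1 P : mod_cat L)
  (i1 : phom Om2 Q) (p1 : phom Q Om1) (i0 : phom Om1 P) (p0 : phom P A)
  (hex1 : exact_sequence i1 p1) (hex0 : exact_sequence i0 p0)
  (hcov1 : projective_cover p1) (hcov0 : projective_cover p0) :
  @almost_split_sequence (H_cat L) (mor_in (@Gprj L))
    (Hobj p1) (hsum (Hobj (i0 \oh p1)) (Hobj (hid Om1))) (Hobj i0)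
    (hcol (phi1 p1 i0) (phi2 p1)) (hrow (psi1 p1 i0) (psi2 i0)) /\
  @indecomposable (H_cat L) (Hobj (i0 \oh p1)).
Proof.
case: hL => hart _ hss; split.
  exact: syzygy_almost_split_sequence hcov0.
exact: middle_indecomposable hcov0.
Qed.
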